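(* Let $d\geq 4$ and let $\Delta$ be a prime homology $(d-1)$-sphere over a field $\mathbb{F}$ with $g_2(\Delta)>0$. Then for every edge $e$ of $\Delta$, the graph $G(\Delta)-e$ is generically $d$-rigid.
   Context: A simplicial complex $\Delta$ on a finite vertex set $V$ is a family of subsets of $V$ closed under taking subsets and containing every singleton; it is pure if all facets have the same dimension ($\dim\sigma=|\sigma|-1$). The link of a face is $\operatorname{lk}_\Delta\sigma=\{\tau\setminus\sigma:\sigma\subseteq\tau\in\Delta\}$. A pure $(d-1)$-dimensional complex $\Delta$ is a homology $(d-1)$-sphere over $\mathbb{F}$ if $\tilde H_*(\operatorname{lk}_\Delta\sigma;\mathbb{F})\cong\tilde H_*(\mathbb{S}^{d-1-|\sigma|};\mathbb{F})$ for every face $\sigma$, including the empty face. A missing face is a non-face all of whose proper subsets are faces; a pure $(d-1)$-dimensional complex is prime if it has no missing $(d-1)$-dimensional faces (missing facets). $g_2(\Delta)=f_1(\Delta)-d f_0(\Delta)+\binom{d+1}{2}$, where $f_0,f_1$ are the numbers of vertices and edges. $G(\Delta)$ is the graph of $\Delta$; $G-e$ deletes the edge $e$. For a graph $G=(V,E)$ and $\phi:V\to\mathbb{R}^d$, $\mathrm{Rig}(G,\phi)$ is the $|E|\times d|V|$ matrix whose row for edge $\{u,v\}$ has $\phi(u)-\phi(v)$ in the columns of $u$, $\phi(v)-\phi(u)$ in the columns of $v$, zeros elsewhere; $G$ is generically $d$-rigid if for generic $\phi$, $\operatorname{rank}\mathrm{Rig}(G,\phi)=d|V|-\binom{d+1}{2}$.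 *)

(* Defs.v *)
From HB Require Import structures.
From mathcomp Require Import all_boot all_order all_algebra.
Set Implicit Arguments. Unset Strict Implicit. Unset Printing Implicit Defensive.
Import Order.TTheory GRing.Theory Num.Theory.
Local Open Scope ring_scope.

Definition is_complex (V : finType) (D : {set {set V}}) : Prop :=
  (forall s t : {set V}, s \in D -> t \subset s -> t \in D) /\
  (forall v : V, [set v] \in D).

Definition faces (V : finType) (D : {set {set V}}) (k : nat) : {set {set V}} :=
  [set s in D | #|s| == k]%N.

Definition pure_dim (V : finType) (D : {set {set V}}) (d : nat) : Prop :=
  (forall s : {set V}, s \in D -> (#|s| <= d)%N) /\
  (forall s : {set V}, s \in D -> exists2 t : {set V}, t \in D & (s \subset t) && (#|t| == d)%N).

Definition link (V : finType) (D : {set {set V}}) (s : {set V}) : {set {set V}} :=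
  [set t :\: s | t in [set t in D | s \subset t]].

Definition bd_sign (F : fieldType) (V : finType) (s : {set V}) (v : V) : F :=
  (-1) ^+ #|[set u in s | (enum_rank u < enum_rank v)%N]|.

(** boundary map from chains on faces with k vertices to chains on faces with
    k-1 vertices (row-vector convention); for k = 0 it is the zero map, and
    the map from 1-vertex faces to the empty face is the augmentation. *)
Definition bd_mx (F : fieldType) (V : finType) (D : {set {set V}}) (k : nat)
  : 'M[F]_(#|faces D k|, #|faces D k.-1|) :=
  \matrix_(i < #|faces D k|, j < #|faces D k.-1|)
    let s : {set V} := enum_val i in let t : {set V} := enum_val j in
    if (t \subset s) && (#|s :\: t| == 1)%N
    then \sum_(v in s :\: t) bd_sign F s v else 0.

(** dimension over F of the reduced homology group H~_{k-1}(D; F) *)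
Definition rbetti (F : fieldType) (V : finType) (D : {set {set V}}) (k : nat) : nat :=
  (#|faces D k| - \rank (bd_mx F D k) - \rank (bd_mx F D k.+1))%N.

(** homology (d-1)-sphere over F: pure (d-1)-dimensional, and for every face
    s (including the empty face) the link of s has the reduced homology over F
    of the sphere S^{d-1-|s|}: F in degree d-1-|s| (index d-|s| here), 0 else. *)
Definition homology_sphere (F : fieldType) (V : finType) (D : {set {set V}}) (d : nat)
  : Prop :=
  pure_dim D d /\
  forall s : {set V}, s \in D -> forall k : nat,
    rbetti F (link D s) k = (if k == (d - #|s|)%N then 1 else 0)%N.

Definition missing_face (V : finType) (D : {set {set V}}) (t : {set V}) : Prop :=
  t \notin D /\ (forall s : {set V}, s \proper t -> s \in D).

Definition prime_cx (V : finType) (D : {set {set V}}) (d : nat) : Prop :=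
  forall t : {set V}, #|t| = d -> ~ missing_face D t.

Definition g2 (V : finType) (D : {set {set V}}) (d : nat) : int :=
  (#|faces D 2|%:Z - (d * #|faces D 1|)%:Z + ('C(d.+1, 2))%:Z)%R.

Definition graph_edges (V : finType) (D : {set {set V}}) : {set {set V}} := faces D 2.

(** rigidity matrix: rows indexed by the edges (elements of E, each a 2-set),
    columns by pairs (vertex w, coordinate k).  For edge e = {u,w} the entry in
    column (w,k) is phi(w)_k - phi(u)_k (the sum below has the single term u),
    and 0 in columns of vertices not in e. *)
Definition rig_mx (R : fieldType) (V : finType) (d : nat) (E : {set {set V}})
  (phi : V -> 'rV[R]_d) : 'M[R]_(#|E|, #|{: V * 'I_d}|) :=
  \matrix_(i < #|E|, j < #|{: V * 'I_d}|)
    let e : {set V} := enum_val i in let p : V * 'I_d := enum_val j in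
    if p.1 \in e then \sum_(u in e :\ p.1) (phi p.1 0 p.2 - phi u 0 p.2) else 0.

Definition alg_indep (R : numFieldType) (T : finType) (x : T -> R) : Prop :=
  forall (s : seq {ffun T -> nat}) (c : {ffun T -> nat} -> rat),
    uniq s ->
    \sum_(m <- s) ratr (c m) * \prod_(t : T) x t ^+ m t = 0 ->
    forall m, m \in s -> c m = 0.

Definition generic_embedding (R : numFieldType) (V : finType) (d : nat)
  (phi : V -> 'rV[R]_d) : Prop :=
  alg_indep (fun p : V * 'I_d => phi p.1 0 p.2).

(** generically d-rigid graph on vertex set V with edge set E: for generic
    phi : V -> R^d, rank Rig(G,phi) = d|V| - C(d+1,2).  The real field R is
    universally quantified (the paper's case is R = the reals). *)
Definition generically_rigid (V : finType) (E : {set {set V}}) (d : nat) : Prop :=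
  forall (R : realFieldType) (phi : V -> 'rV[R]_d),
    generic_embedding phi ->
    (\rank (rig_mx E phi))%:Z = (d * #|V|)%:Z - ('C(d.+1, 2))%:Z.

(* Main.v *)
Require Import Defs.
From HB Require Import structures.
From mathcomp Require Import all_boot all_order all_algebra.
From mathcomp Require Import mpoly ring zify.
Import Order.TTheory GRing.Theory Num.Theory.
Set Implicit Arguments. Unset Strict Implicit. Unset Printing Implicit Defensive.

(** Generic rigidity is treated at one fixed placement with algebraically
    independent coordinates, where every rigidity matrix attains its maximal rank.

    Modulo 2 the facets of a homology sphere, and of each of its links, form a
    minimal cycle: ridges lie in exactly two facets and links of smaller faces are
    connected.  By Fogelsanger's argument (contract an edge uv, split the rest into
    irreducible pieces, rebuild the pieces by vertex splitting and glue them along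
    d common vertices) the graph of the join of a simplex T with a minimal cycle of
    r-sets, r >= 3 and |T| + r = d, is generically d-rigid.

    Let uv be an edge of the prime sphere.
    - If uv lies in a missing face S with |S| >= 3, primeness and g2 > 0 force
      |S| < d; the star of S \ uv is rigid, contains u and v, and does not use uv.
    - Otherwise contracting uv yields a minimal cycle.  If u and v have at least d
      neighbours in the link of uv, vertex splitting does not need the bar uv.
    - If the link of uv is the boundary of a simplex N, then N is not a face by
      primeness, and the bistellar flip replacing uv * bd(N) by bd(uv) * N is again
      a minimal cycle, whose graph avoids uv. *)

(** * Cycles modulo 2 *)

Section Cycles.
Variable V : finType.
Implicit Types (C L M Z : {set {set V}}) (s t T : {set V}) (r : nat).

(** Only degree-0 information is drawn from the homology: index 1 of [rbetti], for links of ridges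
    and of smaller faces. After that no sign or orientation survives, and chains modulo 2 are
    handled as plain sets.

    The obstacle is that identifying u with v can destroy minimality, and simplices that become
    equal cancel. The pieces are therefore cut out before contracting, as indecomposable half cycles
    on the original vertices; their contractions are minimal cycles on fewer vertices unless the
    piece is a single cancelling pair. A hinge simplex of the part already rebuilt that is foreign
    to C must also be a hinge simplex of the rest, and this supplies the d common vertices for the
    next gluing.

    The factor T is carried along because the star of a face is its join with the minimal cycle of
    its link.

    The condition g2 > 0 enters by excluding the boundary of the d-simplex, where g2 = 0. The bound
    d >= 4 is decisive in the flip: N then has at least three vertices, so the flip creates no edge,
    whereas for d = 3 it would trade uv for the edge N. *)

Definition deg C t := #|[set s in C | t \subset s]|.

(* Chains modulo 2 are sets of r-sets: every (r-1)-set must lie in evenly many. *)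
Definition is_cycle r C : bool :=
  [forall s in C, #|s| == r] && [forall t : {set V}, (#|t|.+1 == r) ==> ~~ odd (deg C t)].

Lemma is_cycleP r C : reflect ((forall s, s \in C -> #|s| = r) /\
    (forall t, #|t|.+1 = r -> odd (deg C t) = false)) (is_cycle r C).
Proof.
apply: (iffP andP) => [[/forall_inP h1 /forallP h2]|[h1 h2]]; split.
- by move=> s /h1/eqP.
- by move=> t ht; have /implyP := h2 t; rewrite ht eqxx => /(_ isT)/negPf.
- by apply/forall_inP => s /h1 ->.
- by apply/forallP => t; apply/implyP => /eqP/h2 ->.
Qed.

Definition minimal_cycle r C : Prop :=
  [/\ is_cycle r C, C != set0 & forall Z, Z \subset C -> is_cycle r Z -> Z = set0 \/ Z = C].

Lemma odd_deg_ex C t : odd (deg C t) -> exists2 s, s \in C & t \subset s.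
Proof.
have [h0|[s]] := set_0Vmem [set s in C | t \subset s]; first by rewrite /deg h0 cards0.
by rewrite inE => /andP [hs ht] _; exists s.
Qed.

Lemma deg0 C t : (forall s, s \in C -> ~~ (t \subset s)) -> deg C t = 0.
Proof.
move=> h; apply/eqP; rewrite cards_eq0; apply/eqP/setP => s; rewrite !inE.
by apply/negP => /andP [/h /negPf ->].
Qed.

Lemma degD C Z t : Z \subset C -> odd (deg (C :\: Z) t) = odd (deg C t) (+) odd (deg Z t).
Proof.
move=> hZ; have -> : deg (C :\: Z) t = deg C t - deg Z t.
  rewrite /deg -cardsDS; last first.
    by apply/subsetP => s; rewrite !inE => /andP [/(subsetP hZ) -> ->].
  by apply: eq_card => s; rewrite !inE; case: (s \in Z); case: (t \subset s); rewrite ?andbF.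
rewrite oddB // subset_leq_card //.
by apply/subsetP => s; rewrite !inE => /andP [/(subsetP hZ) -> ->].
Qed.

Lemma degU C Z t : [disjoint C & Z] -> deg (C :|: Z) t = deg C t + deg Z t.
Proof.
move=> hd; rewrite /deg -cardsUI -[LHS]addn0; congr (_ + _).
  by apply: eq_card => s; rewrite !inE andb_orl.
apply/esym/eqP; rewrite cards_eq0; apply/eqP/setP => s; rewrite !inE.
have /pred0P/(_ s) /= := hd.
by case: (s \in C); case: (s \in Z); rewrite ?andbF.
Qed.

Lemma even_deg_other C t : odd (deg C t) = false -> forall s, s \in C -> t \subset s ->
  exists s', [/\ s' \in C, t \subset s' & s' != s].
Proof.
move=> hd s hs hts.
have [h|[s']] := set_0Vmem ([set s in C | t \subset s] :\ s).
  by move: hd; rewrite /deg (cardsD1 s) h cards0 inE hs hts.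
by rewrite !inE => /and3P [h1 h2 h3]; exists s'.
Qed.

Lemma is_cycleD r C Z : Z \subset C -> is_cycle r C -> is_cycle r Z -> is_cycle r (C :\: Z).
Proof.
move=> hZ /is_cycleP [h1 h2] /is_cycleP [h3 h4]; apply/is_cycleP; split.
  by move=> s; rewrite inE => /andP [_ /h1].
by move=> t ht; rewrite degD // h2 // h4.
Qed.

Definition vert C : {set V} := \bigcup_(s in C) s.

Lemma vertP C x : reflect (exists2 s, s \in C & x \in s) (x \in vert C).
Proof. exact: bigcupP. Qed.

Lemma vert_sup C s : s \in C -> s \subset vert C.
Proof. by move=> hs; apply/subsetP => x hx; apply/vertP; exists s. Qed.

(* Edges of the join of the simplex T with the complex generated by C. *)
Definition join_graph (T : {set V}) C : {set {set V}} :=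
  [set e : {set V} | (#|e| == 2) && [exists s in C, e \subset T :|: s]].

Lemma join_graphP T C (e : {set V}) : reflect (#|e| = 2 /\ exists2 s, s \in C & e \subset T :|:
  s) (e \in join_graph T C).
Proof.
rewrite inE; apply: (iffP andP) => [[/eqP he /exists_inP h]|[-> h]]; split => //.
exact/exists_inP.
Qed.

Lemma join_graphS T C C' : C \subset C' -> join_graph T C \subset join_graph T C'.
Proof.
move=> /subsetP h; apply/subsetP => e /join_graphP [he [s /h hs hes]]; apply/join_graphP.
by split=> //; exists s.
Qed.

Lemma join_graph_pair T C s a b : a != b -> s \in C -> a \in T :|: s -> b \in T :|: s -> [set a;
  b] \in join_graph T C.
Proof.
move=> hab hs ha hb; apply/join_graphP; rewrite cards2 hab; split=> //; exists s => //.
by rewrite subUset !sub1set ha.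
Qed.

(** * Half cycles, their fillings and irreducible pieces *)

Section Contraction.
Variables (r : nat) (u v : V).
Hypothesis huv : u != v.

(* L is a chain without simplices containing the edge uv that becomes a cycle when u
   is identified with v; filling it with the simplices of [hinge L], all of which
   contain uv, turns it into an actual cycle. *)
Definition half_cycle L : bool :=
  [&& [forall s in L, (#|s| == r) && ~~ ((u \in s) && (v \in s))],
      [forall t : {set V}, [&& #|t|.+1 == r, u \notin t & v \notin t] ==> ~~ odd (deg L t)] &
      [forall s : {set V}, [&& #|s| == r, u \in s & v \in s] ==>
          (odd (deg L (s :\ u)) == odd (deg L (s :\ v)))]].

Lemma half_cycleP L : reflect
  [/\ forall s, s \in L -> #|s| = r /\ ((u \in s) && (v \in s) = false),
      forall t, #|t|.+1 = r -> u \notin t -> v \notin t -> odd (deg L t) = false &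
      forall s, #|s| = r -> u \in s -> v \in s -> odd (deg L (s :\ u)) = odd (deg L (s :\ v))]
  (half_cycle L).
Proof.
apply: (iffP and3P) => [[/forall_inP h1 /forallP h2 /forallP h3]|[h1 h2 h3]]; split.
- by move=> s /h1/andP [/eqP ? /negPf].
- move=> t ht tu tv; have := h2 t; by rewrite ht eqxx tu tv => /negPf.
- by move=> s hs su sv; have := h3 s; rewrite hs eqxx su sv => /eqP.
- by apply/forall_inP => s /h1 [-> ->]; rewrite eqxx.
- by apply/forallP => t; apply/implyP => /and3P [/eqP a b c]; rewrite h2.
- by apply/forallP => s; apply/implyP => /and3P [/eqP a b c]; rewrite h3.
Qed.

Definition hinge L : {set {set V}} :=
  [set s : {set V} | [&& #|s| == r, u \in s, v \in s & odd (deg L (s :\ v))]].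

Definition fill L := L :|: hinge L.

Lemma hinge_disjoint L : half_cycle L -> [disjoint L & hinge L].
Proof.
case/half_cycleP => h1 _ _; apply/pred0P => s /=; apply/negP => /andP [/h1 [_ h]].
by rewrite inE => /and4P [_ a b _]; rewrite a b in h.
Qed.

(** The only simplex through u and v that can lie over t is [v |: t], and it is in the hinge exactly
    when t is on the mod 2 boundary of L; the filling thus cancels that boundary. *)
Lemma hinge_deg L t : #|t|.+1 = r -> u \in t -> v \notin t -> deg (hinge L) t = odd (deg L t).
Proof.
move=> ht tu tv; have e : (v |: t) :\ v = t by rewrite setU1K.
have hin : (v |: t \in hinge L) = odd (deg L t).
  by rewrite inE cardsU1 tv add1n ht eqxx !inE tu eqxx orbT /= e.
rewrite -hin /deg; have -> : [set s in hinge L | t \subset s] = if v |: t \in hinge L then [set v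
  |: t] else set0.
  apply/setP => s; rewrite inE.
  have -> : (s \in hinge L) && (t \subset s) = (v |: t \in hinge L) && (s == v |: t).
    apply/andP/andP => [[hs hts]|[hs /eqP ->]]; last by rewrite hs subsetUr.
    have es : s = v |: t.
      apply/eqP; rewrite eq_sym eqEcard cardsU1 tv add1n ht.
      move: hs; rewrite inE => /and4P [/eqP -> su sv _].
      by rewrite leqnn andbT subUset sub1set sv.
    by rewrite -es hs.
  by case: ifP; rewrite !inE.
by case: ifP; rewrite ?cards1 ?cards0.
Qed.

End Contraction.

Lemma hingeC r u v L : half_cycle r u v L -> hinge r u v L = hinge r v u L.
Proof.
move=> /half_cycleP [_ _ h3]; apply/setP => s; rewrite !inE.
by case: (boolP (u \in s)) => su; case: (boolP (v \in s)) => sv; rewrite ?andbF //;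
  case: eqP => //= hs; rewrite h3.
Qed.

Lemma odd_sum (I : finType) (P : pred I) (F : I -> nat) :
  odd (\sum_(i | P i) F i) = odd #|[set i | P i && odd (F i)]|.
Proof.
have -> : #|[set i | P i && odd (F i)]| = \sum_(i | P i) odd (F i).
  by rewrite -sum1_card big_mkcond [RHS]big_mkcond; apply: eq_bigr => i _; rewrite inE;
    case: (P i); case: (odd _).
by rewrite !(big_morph odd oddD (erefl _)); apply: eq_bigr => i _; rewrite oddb.
Qed.

Section Filling.
Variables (r : nat) (u v : V).
Hypothesis huv : u != v.
Local Notation half_cycle := (half_cycle r u v).
Local Notation hinge := (hinge r u v).
Local Notation fill := (fill r u v).

(* The boundary of a boundary vanishes. *)
Lemma hinge_deg_even L t : half_cycle L -> #|t|.+1 = r -> u \in t -> v \in t -> odd (deg (hinge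
  L) t) = false.
Proof.
move=> hL ht tu tv; have /half_cycleP [h1 _ _] := hL.
pose t' := t :\ v; have tt' x : x \notin t -> (x |: t) :\ v = x |: t'.
  move=> hx; rewrite /t' setDUl; congr (_ :|: _); apply/setP => y; rewrite !inE.
  by case: (eqVneq y x) => [->|_]; rewrite ?andbF // andbT; apply: contraNneq hx => ->.
(* A hinge simplex over t is some [x |: t], recognised by its face [x |: t'] from which v is
   dropped. *)
have -> : deg (hinge L) t = #|[set x | (x \notin t) && odd (deg L (x |: t'))]|.
  rewrite /deg -(card_in_imset (f := fun x => x |: t)); last first.
    move=> x y; rewrite !inE => /andP [hx _] /andP [hy _] h.
    have : x \in y |: t by rewrite -h setU11.
    by rewrite !inE (negPf hx) orbF => /eqP.
  apply: eq_card => s; apply/idP/imsetP => [|[x]].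
    rewrite !inE => /andP [/and4P [/eqP hs su sv ho] hts].
    have /cards1P [x hx] : #|s :\: t| == 1 by rewrite cardsDS // hs -ht subSnn.
    have hxt : x \notin t.
      by have := set11 x; rewrite -hx inE => /andP [].
    have e : s = x |: t.
      apply/setP => y; rewrite -hx !inE; case: (boolP (y \in t)) => [/(subsetP hts) -> //|_].
      by rewrite orbF.
    by exists x => //; rewrite inE hxt -tt' // -e.
  rewrite !inE => /andP [hx ho] ->; rewrite subsetUr andbT.
  by rewrite cardsU1 hx add1n ht eqxx !inE tu tv !orbT tt'.
(* Double count pairs of x and s in L with [x |: t'] inside s: each s over [t'] avoids v, so it is
   counted by exactly the two vertices of [s :\: t']. *)
rewrite -odd_sum; rewrite /deg.
under eq_bigr => x _ do rewrite -sum1_card.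
rewrite (exchange_big_dep (fun s => s \in [set s in L | t' \subset s])) /=; last first.
  by move=> x s _; rewrite !inE subUset => /and3P [-> _ ->].
rewrite (eq_bigr (fun=> 2)); first by rewrite sum_nat_const oddM andbF.
move=> s; rewrite inE => /andP [hs hts]; rewrite sum1_card.
have [cs nuv] := h1 s hs.
have sv : v \notin s.
  move: nuv; have -> : u \in s by apply: (subsetP hts); rewrite !inE huv.
  by move=> /= ->.
have -> : 2 = #|s :\: t'| by rewrite cardsDS // cs -ht (cardsD1 v t) tv /t'; lia.
apply: eq_card => x; rewrite -[LHS]topredE /= !inE.
rewrite hs subUset sub1set hts andbT.
by case: (eqVneq x v) => [->|]; rewrite ?tv ?(negPf sv).
Qed.

(** At a face with both u and v only the hinge counts; with one of them the hinge cancels L; with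
    neither, a hinge simplex over it would need r + 1 vertices. *)
Lemma fill_cycle L : half_cycle L -> is_cycle r (fill L).
Proof.
move=> hL; have /half_cycleP [h1 h2 h3] := hL; apply/is_cycleP; split=> [s|t ht].
  by rewrite inE => /orP [/h1 []//|]; rewrite inE => /and4P [/eqP].
rewrite degU ?hinge_disjoint // oddD.
have [tu|tu] := boolP (u \in t); have [tv|tv] := boolP (v \in t).
- rewrite hinge_deg_even // addbF deg0 // => s /h1 [_ hs]; apply/negP => /subsetP hts.
  by rewrite !hts in hs.
- by rewrite hinge_deg // oddb addbb.
- by rewrite hingeC // hinge_deg 1?eq_sym // oddb addbb.
- rewrite h2 // deg0 // => s; rewrite inE => /and4P [/eqP hs su sv _]; apply/negP => hts.
  have : u |: (v |: t) \subset s by rewrite !subUset !sub1set su sv.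
  by move/subset_leq_card; rewrite !cardsU1 !inE negb_or huv tu tv hs -ht; lia.
Qed.

Lemma half_cycleD L M : M \subset L -> half_cycle L -> half_cycle M -> half_cycle (L :\: M).
Proof.
move=> hM /half_cycleP [h1 h2 h3] /half_cycleP [g1 g2 g3]; apply/half_cycleP; split.
- by move=> s; rewrite inE => /andP [_ /h1].
- by move=> t ht tu tv; rewrite degD // h2 // g2.
- by move=> s hs su sv; rewrite !degD // h3 // g3.
Qed.

Lemma half_cycleU L M : [disjoint L & M] -> half_cycle L -> half_cycle M -> half_cycle (L :|: M).
Proof.
move=> hM /half_cycleP [h1 h2 h3] /half_cycleP [g1 g2 g3]; apply/half_cycleP; split.
- by move=> s; rewrite inE => /orP [/h1|/g1].
- by move=> t ht tu tv; rewrite degU // oddD h2 // g2.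
- by move=> s hs su sv; rewrite !degU // !oddD h3 // g3.
Qed.

Lemma in_hingeD L M s : M \subset L ->
  (s \in hinge (L :\: M)) = (s \in hinge L) (+) (s \in hinge M).
Proof.
move=> hM; rewrite !inE degD //.
by case: (#|s| == r); case: (u \in s); case: (v \in s).
Qed.

(** The empty chain qualifies; where a nonempty one is needed, a hinge simplex provides it. *)
Definition irreducible L : Prop :=
  half_cycle L /\ forall M, M \subset L -> half_cycle M -> M = set0 \/ M = L.

(** Take a half cycle minimal among those with s in the hinge. Hinges add modulo 2, so for a half
    cycle N inside it either N or its complement still has s, and minimality leaves only trivial
    N. *)
Lemma irreducible_ex L s : half_cycle L -> s \in hinge L ->
  exists M, [/\ M \subset L, irreducible M & s \in hinge M].
Proof.
move=> hL hs; pose P M := half_cycle M && (s \in hinge M).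
have [|M /minsetP [/andP [gM sM] hmin] hML] := @minset_exists _ P L; first by rewrite /P hL.
exists M; split=> //; split=> // N hN gN.
have [sN|sN] := boolP (s \in hinge N); first by right; apply: hmin; rewrite // /P gN.
left; have e : M :\: N = M.
  by apply: hmin; rewrite ?subsetDl // /P half_cycleD // in_hingeD // sM (negPf sN).
by apply/setP => x; rewrite inE; apply/negP => hx; have := subsetP hN _ hx; rewrite -e inE hx.
Qed.

Definition off_edge C : {set {set V}} := [set s in C | ~~ ((u \in s) && (v \in s))].

Lemma off_edgeS C : off_edge C \subset C.
Proof. by apply/subsetP => s; rewrite inE => /andP []. Qed.

Lemma off_edge_deg C t : is_cycle r C -> #|t|.+1 = r ->
  odd (deg (off_edge C) t) =
  odd (#|[set s in C | [&& t \subset s, u \in s & v \in s]]|).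
Proof.
move=> /is_cycleP [_ hC] /hC ho; set B := [set s in C | _].
have e : deg C t = #|B| + deg (off_edge C) t.
  rewrite /deg -(cardsID [set s : {set V} | (u \in s) && (v \in s)] [set s in C | t \subset s]).
  congr (_ + _); apply: eq_card => s; rewrite !inE.
    by case: (s \in C); case: (t \subset s).
  by case: (s \in C); case: (t \subset s); case: (u \in s); case: (v \in s).
by move: ho; rewrite e oddD; case: (odd _); case: (odd _).
Qed.

Lemma off_edge_degD1 C s x : is_cycle r C -> #|s| = r -> u \in s -> v \in s -> (x == u) || (x ==
  v) ->
  odd (deg (off_edge C) (s :\ x)) = (s \in C).
Proof.
move=> hC cs su sv hx.
have xs : x \in s by case/orP: hx => /eqP ->.
rewrite off_edge_deg //; last by rewrite -cs (cardsD1 x s) xs.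
suff -> : [set s' in C | [&& s :\ x \subset s', u \in s' & v \in s']] = if s \in C then [set s]
  else set0.
  by case: ifP; rewrite ?cards1 ?cards0.
apply/setP => s'; have -> : (s' \in (if s \in C then [set s] else set0)) = (s \in C) && (s' == s).
  by case: ifP; rewrite !inE.
rewrite inE; apply/idP/idP => [/and4P [hs' hss' su' sv']|/andP [hs /eqP ->]];
  last by rewrite hs subsetDl su sv.
have xs' : x \in s' by case/orP: hx => /eqP ->.
have e : s = s'.
  apply/eqP; rewrite eqEcard cs; case/is_cycleP: hC => hc _; rewrite (hc _ hs') leqnn andbT.
  by rewrite -(setD1K xs) subUset sub1set xs'.
by rewrite e hs' eqxx.
Qed.

Lemma off_edge_half_cycle C : is_cycle r C -> half_cycle (off_edge C).
Proof.
move=> hC; have /is_cycleP [h1 h2] := hC; apply/half_cycleP; split.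
- by move=> s; rewrite inE => /andP [/h1 -> /negPf].
- move=> t ht tu tv; rewrite off_edge_deg //.
  suff -> : [set s in C | [&& t \subset s, u \in s & v \in s]] = set0 by rewrite cards0.
  apply/setP => s; rewrite !inE.
  apply/negP => /and4P [/h1 hs hts su sv].
  have : u |: (v |: t) \subset s by rewrite !subUset !sub1set su sv.
  by move/subset_leq_card; rewrite !cardsU1 !inE negb_or huv tu tv hs -ht; lia.
- by move=> s hs su sv; rewrite !off_edge_degD1 // eqxx ?orbT.
Qed.

Lemma off_edge_fill C : is_cycle r C -> fill (off_edge C) = C.
Proof.
move=> hC; apply/setP => s; rewrite !inE.
have [hs|hs] := boolP (s \in C).
  have /is_cycleP [/(_ _ hs) cs _] := hC; rewrite cs eqxx /=.
  case: (boolP (u \in s)) => su //=; case: (boolP (v \in s)) => sv //=.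
  by rewrite off_edge_degD1 // eqxx orbT.
rewrite /=; apply/negP => /and4P [/eqP cs su sv].
by rewrite off_edge_degD1 ?eqxx ?orbT // (negPf hs).
Qed.

Lemma hinge_off_edge C s : is_cycle r C -> (s \in hinge (off_edge C)) = [&& s \in C, u \in s & v
  \in s].
Proof.
move=> hC; rewrite inE; have [su|] := boolP (u \in s); last by rewrite !andbF.
have [sv|] := boolP (v \in s); last by rewrite !andbF.
rewrite /= andbT; have [cs|ncs] := eqVneq; first by rewrite off_edge_degD1 ?eqxx ?orbT.
by apply/esym/negP; case/is_cycleP: hC => hc _ /hc/eqP; rewrite (negPf ncs).
Qed.

(** * The contraction map and minimality of contracted pieces *)

Definition contract s := if u \in s then v |: (s :\ u) else s.

(** Two simplices with the same contraction, whose images would cancel modulo 2. *)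
Definition has_pair L := [exists s in L, (u \in s) && (v |: (s :\ u) \in L)].

(** The two simplices form a half cycle by themselves: a face avoiding u and v lies in both or in
    neither, and the boundaries at u and at v match. Irreducibility leaves nothing else. *)
Lemma irreducible_pair L : irreducible L -> has_pair L ->
  exists s : {set V}, [/\ u \notin s, v \notin s & L = [set u |: s; v |: s]].
Proof.
move=> [hL hmin] /exists_inP [s hs /andP [su hs']]; exists (s :\ u).
have /half_cycleP [h1 _ _] := hL; have [cs /negP nuv] := h1 _ hs.
have sv : v \notin s by apply/negP => sv; apply: nuv; rewrite su.
split; rewrite ?inE ?eqxx ?(negPf sv) ?andbF //.
rewrite setD1K //; have hsub : [set s; v |: s :\ u] \subset L by rewrite subUset !sub1set hs.
have hne : s != v |: s :\ u by apply: contraNneq sv => ->; rewrite setU11.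
have degE t : deg [set s; v |: s :\ u] t = (t \subset s) + (t \subset v |: s :\ u).
  rewrite /deg -sum1_card (eq_bigl (fun s0 => (s0 \in [set s; v |: s :\ u]) && (t \subset s0)));
    last by move=> x; rewrite inE.
  by rewrite big_mkcondr big_setU1 ?inE //= big_set1; do 2!case: ifP.
case: (hmin _ hsub); last by move->.
- apply/half_cycleP; split.
  + by move=> t; rewrite !inE => /orP [] /eqP ->; apply: h1.
  + move=> t ht tu tv; rewrite degE.
    suff -> : (t \subset s) = (t \subset v |: s :\ u) by rewrite oddD addbb.
    apply/subsetP/subsetP => h x hx; have := h x hx.
      by rewrite !inE => ->; rewrite andbT orbC; have [e|//] := eqVneq x u;
        rewrite e (negPf tu) in hx.
    by rewrite !inE => /orP [/eqP e|/andP [] //]; rewrite e (negPf tv) in hx.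
  + move=> t ct tu tv; rewrite !degE.
    have n1 : (t :\ u \subset s) = false.
      by apply/negP => /subsetP /(_ v); rewrite !inE eq_sym huv tv => /(_ isT); apply/negP.
    have n2 : (t :\ v \subset v |: s :\ u) = false.
      by apply/negP => /subsetP /(_ u); rewrite !inE (negPf huv) tu eqxx => /(_ isT).
    rewrite n1 n2 addn0 add0n; congr (odd (nat_of_bool _)).
    apply/subsetP/subsetP => h x; rewrite !inE => /andP [hx xt].
      have [->//|xu] := eqVneq x u.
      by have := h x; rewrite !inE xu xt (negPf hx) => /(_ isT) /andP [].
    by have [//|xv] := eqVneq x v; rewrite /= hx; apply: h; rewrite !inE xv xt.
- by move=> h; have := set21 s (v |: s :\ u); rewrite h inE.
Qed.

Lemma contract_inj L : half_cycle L -> ~~ has_pair L -> {in L &, injective contract}.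
Proof.
move=> /half_cycleP [h1 _ _] hp s s' hs hs'; rewrite /contract.
have notv q : q \in L -> u \in q -> v \notin q.
  by move=> /h1 [_ /negP h] qu; apply/negP => qv; apply: h; rewrite qu.
have nopair q : q \in L -> u \in q -> v |: q :\ u \notin L.
  move=> hq qu; apply: contra hp => h; apply/exists_inP; exists q => //; exact/andP.
case: ifP => su; case: ifP => su' //.
- move=> /(congr1 (fun q => u |: q :\ v)).
  have e q : q \in L -> u \in q -> u |: (v |: q :\ u) :\ v = q.
    by move=> hq qu; rewrite setU1K ?setD1K // !inE (negPf (notv q hq qu)) andbF.
  by rewrite !e.
- by move=> h; have := nopair s hs su; rewrite h hs'.
- by move=> h; have := nopair s' hs' su'; rewrite -h hs.
Qed.

Lemma card_contract L s : half_cycle L -> s \in L -> #|contract s| = r.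
Proof.
move=> /half_cycleP [h1 _ _] /h1 [cs nuv]; rewrite /contract; case: ifP => [su|//].
rewrite cardsU1 -cs [in RHS](cardsD1 u) su !inE.
by move: nuv; rewrite su /= => ->; rewrite andbF.
Qed.

Lemma contract_notin s : u \notin contract s.
Proof. by rewrite /contract; case: ifP => [su|->//]; rewrite !inE eqxx (negPf huv). Qed.

Definition pull L Z : {set {set V}} := [set s in L | contract s \in Z].

Lemma contract_deg_off L Z t : half_cycle L -> ~~ has_pair L -> Z \subset contract @: L -> u
  \notin t -> v \notin t ->
  deg Z t = deg (pull L Z) t.
Proof.
move=> hL hp /subsetP hZ tu tv.
rewrite /deg -(card_in_imset (f := contract) (D := mem [set s in pull L Z | t \subset s]));
  last first.
  by move=> x y; rewrite !inE => /andP [/andP [hx _] _] /andP [/andP [hy _] _];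
    apply: (contract_inj hL hp).
have key s : (t \subset contract s) = (t \subset s).
  rewrite /contract; case: ifP => // su; apply/subsetP/subsetP => h x hx; have := h x hx;
    rewrite !inE.
    by case/orP => [/eqP e|/andP [] //]; rewrite e (negPf tv) in hx.
  by move=> ->; rewrite andbT; apply/orP; right; apply: contraNneq tu => <-.
apply: eq_card => q; apply/idP/imsetP => [|[s]].
  rewrite inE => /andP [hq ht]; have /imsetP [s hs e] := hZ q hq.
  by exists s => //; rewrite !inE hs -key -e hq ht.
by rewrite !inE => /andP [/andP [hs hz] ht] ->; rewrite hz key ht.
Qed.

(** A simplex of Z over t comes from one over t or from one over t with v replaced by u; none is
    counted twice, since no simplex of L contains both u and v. *)
Lemma contract_deg_on L Z t : half_cycle L -> ~~ has_pair L -> Z \subset contract @: L -> u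
  \notin t -> v \in t ->
  deg Z t = deg (pull L Z) t + deg (pull L Z) (u |: (t :\ v)).
Proof.
move=> hL hp /subsetP hZ tu tv; have /half_cycleP [h1 _ _] := hL.
rewrite /deg -cardsUI [X in _ + X](_ : _ = 0) ?addn0; last first.
  apply/eqP; rewrite cards_eq0; apply/eqP/setP => s; rewrite !inE.
  apply/negP => /andP [/andP [/andP [/h1 [_ nuv] _] ht]] /andP [_ hut].
  by move: nuv; rewrite (subsetP ht _ tv) (subsetP hut) ?setU11.
rewrite -(card_in_imset (f := contract)
  (D := mem ([set s in pull L Z | t \subset s] :|: [set s in pull L Z | u |: t :\ v \subset
    s]))); last first.
  move=> x y; rewrite !inE.
  by move=> /orP [] /andP [/andP [hx _] _] /orP [] /andP [/andP [hy _] _];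
    apply: (contract_inj hL hp).
have key s : (t \subset contract s) = (t \subset s) || (u |: (t :\ v) \subset s).
  rewrite /contract; case: ifP => su; last first.
    rewrite [X in _ || X](_ : _ = false) ?orbF //.
    by apply/negP => /subsetP /(_ u); rewrite setU11 su => /(_ isT).
  rewrite subUset sub1set su /=; apply/idP/idP.
    move=> /subsetP h; apply/orP; right; apply/subsetP => x; rewrite !inE => /andP [xv /h].
    by rewrite !inE (negPf xv) => /andP [].
  case/orP => /subsetP h; apply/subsetP => x xt; rewrite !inE.
    by rewrite h // andbT; apply/orP; right; apply: contraNneq tu => <-.
  have [//|xv] := eqVneq x v; rewrite h ?inE ?xv // andbT /=.
  by apply: contraNneq tu => <-.
apply: eq_card => q; apply/idP/imsetP => [|[s]].
  rewrite inE => /andP [hq ht]; have /imsetP [s hs e] := hZ q hq.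
  by exists s => //; rewrite !inE hs -e hq /= -key -e ht.
by rewrite !inE -andb_orr => /andP [/andP [hs hz] ht] ->; rewrite hz key ht.
Qed.

(** The clauses of [half_cycle] are the cycle condition of the contraction read upstairs: faces
    avoiding u and v give the second, faces through v the third. Allowing any Z makes minimality
    carry over. *)
Lemma contract_cycle L Z : half_cycle L -> ~~ has_pair L -> Z \subset contract @: L ->
  is_cycle r Z = half_cycle (pull L Z).
Proof.
move=> hL hp hZ; have /half_cycleP [h1 _ _] := hL.
have pullL s : s \in pull L Z -> s \in L by rewrite inE => /andP [].
apply/is_cycleP/half_cycleP => [[c1 c2]|[g1 g2 g3]]; split.
- by move=> s /pullL/h1.
- by move=> t ht tu tv; rewrite -contract_deg_off // c2.
- move=> s cs su sv; have uu : u \notin s :\ u by rewrite !inE eqxx.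
  have vu : v \in s :\ u by rewrite !inE eq_sym huv.
  have ct : #|s :\ u|.+1 = r by rewrite -cs (cardsD1 u s) su.
  have := c2 _ ct; rewrite (contract_deg_on hL hp hZ) //.
  have -> : u |: s :\ u :\ v = s :\ v.
    by apply/setP => x; rewrite !inE; case: (eqVneq x u) => [->|_] //=; rewrite huv su.
  by rewrite oddD; case: (odd _); case: (odd _).
- by move=> q /(subsetP hZ) /imsetP [s hs ->]; apply: (card_contract hL).
- move=> t ht; have [tu|tu] := boolP (u \in t).
    rewrite deg0 // => q /(subsetP hZ) /imsetP [s hs ->]; apply/negP => /subsetP /(_ u tu).
    by apply/negP/contract_notin.
  have [tv|tv] := boolP (v \in t); last by rewrite (contract_deg_off hL hp hZ) // g2.
  rewrite (contract_deg_on hL hp hZ) // oddD; have := g3 (u |: t).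
  rewrite cardsU1 tu add1n ht !inE eqxx tv orbT => /(_ erefl isT isT).
  have -> : (u |: t) :\ u = t by rewrite setU1K.
  have -> : (u |: t) :\ v = u |: (t :\ v).
    by apply/setP => x; rewrite !inE; case: (eqVneq x u) => [->|_] //=; rewrite huv.
  by move=> ->; rewrite addbb.
Qed.

Lemma contract_minimal_cycle L : irreducible L -> L != set0 -> ~~ has_pair L -> minimal_cycle r
  (contract @: L).
Proof.
move=> [hL hmin] L0 hp.
have pullT : pull L (contract @: L) = L.
  by apply/setP => s; rewrite inE; case: (boolP (s \in L)) => //= hs; apply: imset_f.
split; first by rewrite (contract_cycle hL hp) // pullT.
  by case/set0Pn: L0 => s hs; apply/set0Pn; exists (contract s); apply: imset_f.
move=> Z hZ; rewrite (contract_cycle hL hp) // => gZ.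
have Zim q : q \in Z -> exists2 s, s \in pull L Z & q = contract s.
  by move=> hq; have /imsetP [s hs e] := subsetP hZ _ hq; exists s; rewrite // inE hs -e.
have pL : pull L Z \subset L by apply/subsetP => s; rewrite inE => /andP [].
case: (hmin _ pL gZ) => h; [left|right].
  apply/setP => q; rewrite inE; apply/negP => /Zim [s]; by rewrite h inE.
apply/eqP; rewrite eqEsubset hZ; apply/subsetP => q /imsetP [s hs ->].
by move: hs; rewrite -h inE => /andP [].
Qed.

(** As r >= 3, s has a vertex x besides u and v. The hinge is even at [s :\ x], so a second hinge
    simplex passes there and brings a vertex outside s: an extra common neighbour of u and v. *)
Lemma hinge_common L s : half_cycle L -> 3 <= r -> s \in hinge L ->
  exists y, [/\ y \notin s & exists2 s', s' \in hinge L & y \in s'].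
Proof.
move=> hL r3 hs; have := hs; rewrite inE => /and4P [/eqP cs su sv _].
have [x hx] : exists x, x \in s :\ u :\ v.
  apply/set0Pn; rewrite -card_gt0; move: cs;
    rewrite (cardsD1 u) su (cardsD1 v (s :\ u)) !inE sv eq_sym huv; lia.
move: hx; rewrite !inE => /and3P [xv xu xs].
have ht : #|s :\ x|.+1 = r by rewrite -cs (cardsD1 x s) xs.
have ux : u \in s :\ x by rewrite !inE eq_sym xu.
have vx : v \in s :\ x by rewrite !inE eq_sym xv.
have [s' [hs' hss' ne]] := even_deg_other (hinge_deg_even hL ht ux vx) hs (subsetDl _ _).
have [y hy] : exists y, y \in s' :\: s.
  apply/set0Pn; rewrite setD_eq0; apply: contra ne => h; rewrite eqEcard h cs /=.
  by move: hs'; rewrite inE => /andP [/eqP ->]; rewrite leqnn.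
by move: hy; rewrite inE => /andP [hy hy']; exists y; split => //; exists s'.
Qed.

(** Both [s :\ u] and [s :\ v] have odd degree in L. Hence every edge of a hinge simplex other than
    uv is an edge of L. *)
Lemma hinge_sub L s x : half_cycle L -> s \in hinge L -> (x == u) || (x == v) ->
  exists2 s', s' \in L & s :\ x \subset s'.
Proof.
move=> hL hs /orP [] /eqP ->; apply: odd_deg_ex.
  by move: hs; rewrite (hingeC hL) inE => /and4P [].
by move: hs; rewrite inE => /and4P [].
Qed.

End Filling.
End Cycles.

Local Open Scope ring_scope.

(** * Generic rank *)

Definition ratev (R : numFieldType) (T : finType) (x : T -> R) :
    {mpoly rat[#|T|]} -> R :=
  mmap (ratr : rat -> R) (fun i => x (enum_val i)).

Lemma alg_indep_ratev (R : numFieldType) (T : finType) (x : T -> R)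
    (p : {mpoly rat[#|T|]}) :
  alg_indep x -> ratev x p = 0 -> p = 0.
Proof.
move=> hx; rewrite /ratev /mmap => hp.
pose f (m : 'X_{1..#|T|}) : {ffun T -> nat} := [ffun t => m (enum_rank t)].
pose g (m : {ffun T -> nat}) : 'X_{1..#|T|} := [multinom m (enum_val i) | i < #|T|]%MM.
have fK : cancel f g by move=> m; apply/mnmP => i; rewrite mnmE ffunE enum_valK.
apply/mpolyP => m; rewrite mcoeff0.
case: (boolP (m \in msupp p)) => [hm|]; last by rewrite mcoeff_msupp negbK => /eqP.
have := hx (map f (msupp p)) (fun m => p@_(g m)).
rewrite map_inj_uniq ?msupp_uniq ?(big_map f xpredT); last exact: can_inj fK.
move=> /(_ isT); under eq_bigr => m' _.
  rewrite fK (reindex (enum_val : 'I_#|T| -> T)) /=; last exact/onW_bij/enum_val_bij.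
  under eq_bigr => i _ do rewrite ffunE enum_valK.
  over.
move=> /(_ hp) /(_ (f m)); rewrite fK; apply.
by apply/mapP; exists m.
Qed.

Lemma rank_submatrix (K : fieldType) (m n : nat) (A : 'M[K]_(m, n)) :
  exists (f : 'I_(\rank A) -> 'I_m) (g : 'I_(\rank A) -> 'I_n),
    mxsub f g A \in unitmx.
Proof.
have h1 := @maxrowsub_free K m n A.
set B := rowsub _ A in h1.
have rB : row_full B^T by rewrite /row_full mxrank_tr.
exists (maxrankfun A), (fullrankfun rB).
have -> : mxsub (maxrankfun A) (fullrankfun rB) A = (rowsub (fullrankfun rB) B^T)^T.
  by apply/matrixP => i j; rewrite !mxE.
by rewrite unitmx_tr -row_free_unit -row_leq_rank mxrank_fullrowsub.
Qed.

Lemma mxrank_mxsub (K : fieldType) (m n m' n' : nat) (f : 'I_m' -> 'I_m)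
    (g : 'I_n' -> 'I_n) (A : 'M[K]_(m, n)) :
  (\rank (mxsub f g A) <= \rank A)%N.
Proof.
have -> : mxsub f g A = colsub g (rowsub f A) by apply/matrixP => i j; rewrite !mxE.
rewrite -mxrank_tr; apply: leq_trans (_ : \rank (rowsub f A)^T <= _)%N; last first.
  by rewrite mxrank_tr mxrankS ?rowsub_sub.
rewrite [X in (\rank X <= _)%N](_ : _ = rowsub g (rowsub f A)^T) ?mxrankS ?rowsub_sub //.
by apply/matrixP => i j; rewrite !mxE.
Qed.

(** A minor that is nonzero at y is a nonzero rational polynomial, hence nonzero at the
    algebraically independent x. *)
Lemma generic_rank_max (R : numFieldType) (T : finType) (x y : T -> R) (m n : nat)
    (P : 'M[{mpoly rat[#|T|]}]_(m, n)) :
  alg_indep x ->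
  (\rank (map_mx (ratev y) P) <= \rank (map_mx (ratev x) P))%N.
Proof.
move=> hx; have [f [g]] := rank_submatrix (map_mx (ratev y) P).
rewrite -map_mxsub unitmxE -[ratev y]/(mmap _ _) det_map_mx unitfE => hy.
have: \det (mxsub f g P) != 0 by apply: contraNneq hy => ->; rewrite rmorph0.
move=> /(contra_neq (alg_indep_ratev hx)).
rewrite /ratev -det_map_mx -unitfE -unitmxE map_mxsub -row_free_unit /row_free.
by move=> /eqP hr; rewrite -[X in (X <= _)%N]hr mxrank_mxsub.
Qed.

(* det (1 + t C) is, up to a power of t, a characteristic polynomial at 1 / t. *)
Lemma pencil_rank (K : fieldType) (m n : nat) (A B : 'M[K]_(m, n)) :
  injective (fun i : nat => i%:R : K) ->
  exists2 t : K, t != 0 & (\rank A <= \rank (A + t *: B)%R)%N.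
Proof.
move=> charK; have [f [g hfg]] := rank_submatrix A.
move: (\rank A) f g hfg => r f g hfg.
pose A' := mxsub f g A; pose B' := mxsub f g B.
pose C := invmx A' *m B'.
have hp : char_poly (- C) != 0 by rewrite monic_neq0 // char_poly_monic.
have [s s0 hs] : exists2 s : K, s != 0 & ~~ root (char_poly (- C)) s.
  (* The factor ['X] excludes s = 0. Among [size q] distinct natural numbers one is not a root, and
     t is its inverse. *)
  pose q := 'X * char_poly (- C).
  have q0 : q != 0 by rewrite mulf_neq0 ?polyX_eq0.
  have := max_poly_roots q0 (rs := [seq i%:R | i <- iota 0 (size q)]).
  rewrite size_map size_iota ltnn map_inj_uniq ?iota_uniq; last exact: charK.
  case: (boolP (all _ _)) => [_ /(_ isT isT) //|].
  move=> /allPn [s _ hs] _; exists s; move: hs; rewrite rootM negb_or rootE hornerX => /andP [] //.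
exists s^-1; first by rewrite invr_eq0.
apply: leq_trans (mxrank_mxsub f g _).
have -> : mxsub f g (A + s^-1 *: B) = A' *m (s^-1 *: (s%:M - (- C))).
  rewrite opprK scalerDr scale_scalar_mx mulVf // mulmxDr mulmx1 -scalemxAr.
  by rewrite mulKVmx //; apply/matrixP => i j; rewrite !mxE.
rewrite mxrankMfree; last first.
  rewrite row_free_unit unitmxE detZ unitfE mulf_neq0 ?expf_neq0 ?invr_eq0 //.
  move: hs; rewrite rootE; apply: contraNneq => h.
  rewrite /char_poly -horner_evalE -det_map_mx -[X in _ == X]h; apply/eqP; congr (\det _).
  by apply/matrixP => i j; rewrite !mxE /= /horner_eval !hornerE !hornerMn !hornerE.
by move: hfg; rewrite -row_free_unit /row_free => /eqP hr; rewrite -[X in (X <= _)%N]hr.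
Qed.

(** * Infinitesimal rigidity *)

(** This turns implications between motions into inclusions of row spaces, and so into rank
    inequalities. *)
Lemma submx_kerP (K : fieldType) (m1 m2 n : nat) (A : 'M[K]_(m1, n)) (B : 'M[K]_(m2, n)) :
  (B <= A)%MS <-> forall x : 'cV_n, A *m x = 0 -> B *m x = 0.
Proof.
split=> [/submxP [D ->] x hx|h]; first by rewrite -mulmxA hx mulmx0.
rewrite submxE; apply/eqP/matrixP => i j; rewrite [RHS]mxE.
have := h (col j (cokermx A)); rewrite colE (mulmxA A) mulmx_coker mul0mx mulmxA => /(_ erefl).
by rewrite -colE => /matrixP /(_ i 0); rewrite !mxE.
Qed.

Section Rigidity.
Variables (R : realFieldType) (V : finType) (d : nat).
Implicit Types (phi mu : V -> 'rV[R]_d) (f : V -> V -> 'rV[R]_d).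
Implicit Types (E : {set {set V}}) (U S : {set V}) (u v a b : V).

Definition dot (x y : 'rV[R]_d) : R := (x *m y^T) 0 0.

Lemma dotE x y : dot x y = \sum_k x 0 k * y 0 k.
Proof. by rewrite /dot mxE; apply: eq_bigr => k _; rewrite mxE. Qed.

Lemma dotDl x y z : dot (x + y) z = dot x z + dot y z.
Proof. by rewrite /dot mulmxDl mxE. Qed.

Lemma dotNl x y : dot (- x) y = - dot x y.
Proof. by rewrite /dot mulNmx mxE. Qed.

Lemma dotBl x y z : dot (x - y) z = dot x z - dot y z.
Proof. by rewrite dotDl dotNl. Qed.

Lemma dotZl c x y : dot (c *: x) y = c * dot x y.
Proof. by rewrite /dot -scalemxAl mxE. Qed.

Lemma dotC x y : dot x y = dot y x.
Proof. by rewrite !dotE; apply: eq_bigr => k _; rewrite mulrC. Qed.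

Lemma dotDr x y z : dot z (x + y) = dot z x + dot z y.
Proof. by rewrite dotC dotDl !(dotC z). Qed.

Lemma dotNr x y : dot x (- y) = - dot x y.
Proof. by rewrite dotC dotNl dotC. Qed.

Lemma dotBr x y z : dot z (x - y) = dot z x - dot z y.
Proof. by rewrite dotDr dotNr. Qed.

Lemma dot0l x : dot 0 x = 0.
Proof. by rewrite /dot mul0mx mxE. Qed.

Lemma dot_suml (I : finType) (P : pred I) (F : I -> 'rV[R]_d) y :
  dot (\sum_(i | P i) F i) y = \sum_(i | P i) dot (F i) y.
Proof. by apply: (big_morph (dot^~ y)) => [x z|]; rewrite ?dotDl ?dot0l. Qed.

Definition motion E f mu : Prop :=
  forall a b, a != b -> [set a; b] \in E -> dot (f a b) (mu a - mu b) = 0.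

Definition bars phi a b : 'rV[R]_d := phi a - phi b.

(* Every infinitesimal motion of (E, phi) preserves all distances within U. *)
Definition rigid phi E U : Prop :=
  forall mu, motion E (bars phi) mu ->
    forall a b, a \in U -> b \in U -> dot (phi a - phi b) (mu a - mu b) = 0.

Definition is_graph E := forall e, e \in E -> #|e| = 2.

(* The rigidity matrix with prescribed bar directions f in place of the differences
   of phi; needed for degenerate placements with coinciding endpoints. *)
Definition bar_mx E f : 'M[R]_(#|E|, #|{: V * 'I_d}|) :=
  \matrix_(i < #|E|, j < #|{: V * 'I_d}|)
    let e : {set V} := enum_val i in let p : V * 'I_d := enum_val j in
    if p.1 \in e then \sum_(u in e :\ p.1) f p.1 u 0 p.2 else 0.

Lemma rig_mxE E phi : rig_mx E phi = bar_mx E (bars phi).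
Proof.
apply/matrixP => i j; rewrite !mxE /=; case: ifP => // _.
by apply: eq_bigr => u _; rewrite !mxE.
Qed.

Definition mcol mu : 'cV[R]_#|{: V * 'I_d}| :=
  \col_j mu (enum_val j).1 0 (enum_val j).2.

Lemma mcol_ex (x : 'cV[R]_#|{: V * 'I_d}|) : exists mu, x = mcol mu.
Proof.
exists (fun v => \row_k x (enum_rank (v, k)) 0).
by apply/matrixP => i j; rewrite !mxE -surjective_pairing enum_valK ord1.
Qed.

Definition antisym f := forall a b, f a b = - f b a.

Lemma bars_antisym phi : antisym (bars phi).
Proof. by move=> a b; rewrite /bars opprB. Qed.

Lemma bar_mx_mulE E f mu i a b : antisym f -> a != b -> enum_val i = [set a; b] ->
  (bar_mx E f *m mcol mu) i 0 = dot (f a b) (mu a - mu b).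
Proof.
move=> hf hab hi; rewrite mxE.
rewrite (reindex (@enum_rank {: V * 'I_d})) /=; last exact/onW_bij/enum_rank_bij.
under eq_bigr => j _ do rewrite !mxE /= hi enum_rankK.
rewrite -(pair_bigA _ (fun w k => (if w \in [set a; b] then
  \sum_(u in [set a; b] :\ w) f w u 0 k else 0) * mu w 0 k)) /=.
rewrite (bigID (mem [set a; b])) /= [X in _ + X]big1 ?addr0; last first.
  by move=> w /negPf ->; rewrite big1 // => k _; rewrite mul0r.
rewrite big_setU1 ?inE //= big_set1 !inE !eqxx orbT /= setU1K ?inE //.
rewrite [X in _ + X](eq_bigr (fun k => f b a 0 k * mu b 0 k)); last first.
  by move=> k _; rewrite setUC setU1K ?inE 1?eq_sym // big_set1.
rewrite dotBr !dotE -sumrN; congr (_ + _).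
  by apply: eq_bigr => k _; rewrite big_set1.
by apply: eq_bigr => k _; rewrite (hf b a) !mxE mulNr.
Qed.

Lemma motionP E f mu : is_graph E -> antisym f ->
  motion E f mu <-> bar_mx E f *m mcol mu = 0.
Proof.
move=> hE hf; split=> [h|h a b hab he].
  apply/matrixP => i j; rewrite ord1 [RHS]mxE.
  have hi := enum_valP i; have /eqP/cards2P [a [b [hab hi2]]] := hE _ hi.
  by rewrite (bar_mx_mulE mu hf hab hi2); apply: h; rewrite // -hi2.
by rewrite -(bar_mx_mulE mu hf hab (enum_rankK_in he he)) h mxE.
Qed.

Lemma bar_mx_subP E1 f1 E2 f2 : is_graph E1 -> is_graph E2 -> antisym f1 -> antisym f2 ->
  (bar_mx E2 f2 <= bar_mx E1 f1)%MS <->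
  (forall mu, motion E1 f1 mu -> motion E2 f2 mu).
Proof.
move=> h1 h2 a1 a2; rewrite submx_kerP; split=> h.
  by move=> mu /(motionP mu h1 a1)/h/(motionP mu h2 a2).
move=> x; have [mu ->] := mcol_ex x.
by move=> /(motionP mu h1 a1)/h/(motionP mu h2 a2).
Qed.

Definition pairs U : {set {set V}} := [set e : {set V} | (e \subset U) && (#|e| == 2)%N].

Lemma pairs_is_graph U : is_graph (pairs U).
Proof. by move=> e; rewrite inE => /andP [_ /eqP]. Qed.

Lemma in_pairs U a b : a != b -> ([set a; b] \in pairs U) = (a \in U) && (b \in U).
Proof. by move=> hab; rewrite inE cards2 hab eqxx andbT subUset !sub1set. Qed.

Lemma rigidP phi E U : rigid phi E U <->
  (forall mu, motion E (bars phi) mu -> motion (pairs U) (bars phi) mu).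
Proof.
split=> [h mu /h hmu a b hab|h mu /h hmu a b ha hb].
  by rewrite in_pairs // => /andP [ha hb]; apply: hmu.
have [->|hab] := eqVneq a b; first by rewrite !subrr dot0l.
by apply: hmu; rewrite // in_pairs // ha hb.
Qed.

Lemma rigid_mono phi E E' U U' : E \subset E' -> U' \subset U ->
  rigid phi E U -> rigid phi E' U'.
Proof.
move=> /subsetP hE /subsetP hU h mu hmu a b /hU ha /hU hb; apply: h => //.
by move=> x y hxy /hE; apply: hmu.
Qed.

Lemma rigid_trans phi E E' U : rigid phi E U ->
  (forall mu, motion E' (bars phi) mu -> motion E (bars phi) mu) ->
  rigid phi E' U.
Proof. by move=> h h' mu /h'; apply: h. Qed.

Lemma rigid_pairs phi U : rigid phi (pairs U) U.
Proof. exact/rigidP. Qed.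

End Rigidity.

Lemma ratev_X (R : numFieldType) (T : finType) (x : T -> R) (t : T) :
  ratev x 'X_(enum_rank t) = x t.
Proof. by rewrite /ratev mmapX mmap1U enum_rankK. Qed.

Lemma ratevB (R : numFieldType) (T : finType) (x : T -> R) p q :
  ratev x (p - q) = ratev x p - ratev x q.
Proof. exact: rmorphB. Qed.

Lemma ratev0 (R : numFieldType) (T : finType) (x : T -> R) : ratev x 0 = 0.
Proof. exact: rmorph0. Qed.

Lemma ratev_sum (R : numFieldType) (T : finType) (x : T -> R) (I : finType) (P : pred I) F :
  ratev x (\sum_(i | P i) F i) = \sum_(i | P i) ratev x (F i).
Proof. exact: rmorph_sum. Qed.

Lemma subset_of_card (T : finType) (A : {set T}) k :
  (k <= #|A|)%N -> exists2 B : {set T}, B \subset A & #|B| = k.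
Proof.
rewrite -bin_gt0 -cards_draws card_gt0 => /set0Pn [B].
by rewrite inE => /andP [hB /eqP hk]; exists B.
Qed.

(** * General position, stresses and gluing *)

Section GenericRigidity.
Variables (R : realFieldType) (V : finType) (d : nat) (phi : V -> 'rV[R]_d).
Hypothesis phi_gen : generic_embedding phi.
Implicit Types (mu psi : V -> 'rV[R]_d) (E : {set {set V}}) (U S W : {set V}) (u v a b : V).

Lemma generic_rig_rank psi E : (\rank (rig_mx E psi) <= \rank (rig_mx E phi))%N.
Proof.
pose X (p : V * 'I_d) : {mpoly rat[#|{: V * 'I_d}|]} := 'X_(enum_rank p).
pose P : 'M[{mpoly rat[#|{: V * 'I_d}|]}]_(#|E|, #|{: V * 'I_d}|) :=
  \matrix_(i, j) (let e : {set V} := enum_val i in let p : V * 'I_d := enum_val j in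
  if p.1 \in e then \sum_(u in e :\ p.1) (X (p.1, p.2) - X (u, p.2)) else 0).
have hP (ps : V -> 'rV[R]_d) : rig_mx E ps = map_mx (ratev (fun p : V * 'I_d => ps p.1 0 p.2)) P.
  apply/matrixP => i j; rewrite !mxE /=; case: ifP => _; last by rewrite ratev0.
  by rewrite ratev_sum; apply: eq_bigr => u _; rewrite ratevB /X !ratev_X.
by rewrite !hP; apply: generic_rank_max.
Qed.

Definition spokes S v : 'M[R]_(#|S|, d) := \matrix_(i < #|S|) (phi (enum_val i) - phi v).

Lemma spokes_free S v : v \notin S -> (#|S| <= d)%N -> row_free (spokes S v).
Proof.
move=> hv hS; rewrite -row_leq_rank.
pose X (p : V * 'I_d) : {mpoly rat[#|{: V * 'I_d}|]} := 'X_(enum_rank p).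
pose P : 'M[{mpoly rat[#|{: V * 'I_d}|]}]_(#|S|, d) :=
  \matrix_(i, k) (X (enum_val i, k) - X (v, k)).
(* Special placement: v at the origin, the vertices of S at distinct basis vectors. The spokes are
   independent there, hence also at [phi]. *)
pose y (p : V * 'I_d) : R := ((p.1 \in S) && (index p.1 (enum S) == p.2))%:R.
have hP (x : V * 'I_d -> R) i k : ratev x (P i k) = x (enum_val i, k) - x (v, k).
  by rewrite mxE ratevB /X !ratev_X.
have -> : spokes S v = map_mx (ratev (fun p : V * 'I_d => phi p.1 0 p.2)) P.
  by apply/matrixP => i k; rewrite [RHS]mxE hP !mxE.
apply: leq_trans (generic_rank_max y P phi_gen).
rewrite row_leq_rank; apply/row_freeP.
exists (\matrix_(k < d, i < #|S|) (nat_of_ord k == i)%:R).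
apply/matrixP => i j; rewrite !mxE.
have hid : (j < d)%N by apply: leq_trans hS.
rewrite (bigD1 (Ordinal hid)) //= big1 ?addr0; last first.
  move=> k hk; rewrite [X in _ * X]mxE; case: eqP => [h|]; last by rewrite mulr0.
  by case/eqP: hk; apply: val_inj.
rewrite [X in X * _]mxE hP mxE eqxx mulr1 /y /= enum_valP (negPf hv) subr0 /=.
by rewrite {1}/enum_val index_uniq ?enum_uniq // -?cardE.
Qed.

Lemma spokes_indep S v (c : V -> R) : v \notin S -> (#|S| <= d)%N ->
  \sum_(a in S) c a *: (phi a - phi v) = 0 -> forall a, a \in S -> c a = 0.
Proof.
move=> hv hS h a ha.
have : \row_i c (enum_val i) = 0 :> 'rV[R]_#|S|.
  apply: (row_free_inj (spokes_free hv hS)); rewrite mul0mx mulmx_sum_row -[RHS]h.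
  by rewrite [RHS]big_enum_val; apply: eq_bigr => i _; rewrite mxE rowK.
by move/matrixP/(_ 0 (enum_rank_in ha a)); rewrite !mxE enum_rankK_in.
Qed.

Lemma spokes_orth S v x : v \notin S -> #|S| = d ->
  (forall a, a \in S -> dot (phi a - phi v) x = 0) -> x = 0.
Proof.
move=> hv hS h; have hf : row_free (spokes S v) by rewrite spokes_free // hS.
apply: trmx_inj; rewrite trmx0.
have hfull : row_full (spokes S v) by rewrite /row_full -[X in _ == X]hS.
have : spokes S v *m x^T = 0.
  apply/matrixP => i j; rewrite [RHS]mxE -[RHS](h (enum_val i)) ?enum_valP //.
  by rewrite /dot !mxE; apply: eq_bigr => k _; rewrite !mxE !ord1.
have [B hB] := row_fullP hfull.
by move=> /(congr1 (mulmx B)); rewrite mulmxA hB mul1mx mulmx0.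
Qed.

Lemma spokes_span S v x : v \notin S -> #|S| = d ->
  exists c : V -> R, x = \sum_(a in S) c a *: (phi a - phi v).
Proof.
move=> hv hS; have [S0|[a0 ha0]] := set_0Vmem S.
  exists (fun=> 0); rewrite S0 big_set0; apply/matrixP => i j.
  by move: (leq_ltn_trans (leq0n j) (ltn_ord j)); rewrite -[X in (_ < X)%N]hS S0 cards0.
have hf : row_free (spokes S v) by rewrite spokes_free // hS.
have hfull : row_full (spokes S v) by rewrite /row_full -[X in _ == X]hS.
have /submxP [D ->] := submx_full x hfull.
exists (fun a => D 0 (enum_rank_in ha0 a)).
rewrite mulmx_sum_row [RHS]big_enum_val; apply: eq_bigr => i _.
by rewrite rowK enum_valK_in.
Qed.

(* An affine dependency l of the points p gives the self-stress l i * l j of the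
   complete graph on them. *)
Lemma stress_identity (I : finType) (P : pred I) (l : I -> R) (p m : I -> 'rV[R]_d) :
  \sum_(i | P i) l i = 0 -> \sum_(i | P i) l i *: p i = 0 ->
  \sum_(i | P i) \sum_(j | P j) l i * l j * dot (p i - p j) (m i - m j) = 0.
Proof.
move=> h1 h2.
have h3 x : \sum_(i | P i) l i * dot (p i) x = 0.
  by rewrite -[RHS](dot0l x) -h2 dot_suml; apply: eq_bigr => i _; rewrite dotZl.
have e i j : l i * l j * dot (p i - p j) (m i - m j) =
  (l i * dot (p i) (m i)) * l j + (l j * dot (p j) (m j)) * l i
  - l i * (l j * dot (p j) (m i)) - l j * (l i * dot (p i) (m j)).
  by rewrite !(dotBl, dotBr); ring.
under eq_bigr => i _ do under eq_bigr => j _ do rewrite e.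
under eq_bigr => i _ do rewrite !sumrB big_split /= -mulr_sumr h1 mulr0 -mulr_suml -mulr_sumr h3
  mulr0 add0r subr0.
rewrite sumrB -mulr_sumr h1 mulr0 exchange_big big1 ?subr0 //= => j _.
by rewrite -mulr_sumr h3 mulr0.
Qed.

(* K_(d+2) minus an edge is rigid in general position: the missing edge carries a
   nonzero coefficient in the stress of the complete graph. *)
Lemma length_implied W a b mu : a \notin W -> b \notin W -> #|W| = d ->
  (forall x y, x \in a |: W -> y \in a |: W -> dot (phi x - phi y) (mu x - mu y) = 0) ->
  (forall x y, x \in b |: W -> y \in b |: W -> dot (phi x - phi y) (mu x - mu y) = 0) ->
  dot (phi a - phi b) (mu a - mu b) = 0.
Proof.
move=> ha hb hW hla hlb.
have [->|hab] := eqVneq a b; first by rewrite !subrr dot0l.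
(* Affine coordinates of b over a and W give the affine dependency l, normalised by [l b = 1]; its
   coefficient at a is then [s - 1]. *)
have [c hc] := spokes_span (phi b - phi a) ha hW.
pose s := \sum_(w in W) c w.
pose l x := if x == a then s - 1 else if x == b then 1 else - c x.
have la : l a = s - 1 by rewrite /l eqxx.
have lb : l b = 1 by rewrite /l eqxx eq_sym (negPf hab).
have lw w : w \in W -> l w = - c w.
  by move=> hw; rewrite /l; do 2?[case: eqP => [e|_]; first by rewrite -e hw in ha hb].
have hbW : b \notin W := hb.
have haW : a \notin b |: W by rewrite !inE negb_or hab.
have sum2 (A : zmodType) (F : V -> A) :
    \sum_(x in a |: (b |: W)) F x = F a + F b + \sum_(w in W) F w.
  by rewrite big_setU1 //= big_setU1 //= addrA.
have h1 : \sum_(x in a |: (b |: W)) l x = 0.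
  rewrite sum2 la lb (eq_bigr (fun w => - c w)) ?sumrN -/s; last exact: lw.
  by ring.
have hs : \sum_(w in W) c w *: phi w = phi b - phi a + s *: phi a.
  by rewrite hc scaler_suml -big_split /=; apply: eq_bigr => w _; rewrite scalerBr subrK.
have h2 : \sum_(x in a |: (b |: W)) l x *: phi x = 0.
  rewrite sum2 la lb [X in _ + X](eq_bigr (fun w => - (c w *: phi w))); last first.
    by move=> w hw; rewrite lw // scaleNr.
  rewrite sumrN hs scalerBl scale1r scale1r opprD opprB addrA.
  by apply/matrixP => i j; rewrite !mxE; ring.
have := stress_identity mu h1 h2.
have z1 x y : x \in a |: W -> y \in a |: W -> l x * l y * dot (phi x - phi y) (mu x - mu y) = 0.
  by move=> hx hy; rewrite hla // mulr0.
have z2 x y : x \in b |: W -> y \in b |: W -> l x * l y * dot (phi x - phi y) (mu x - mu y) = 0.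
  by move=> hx hy; rewrite hlb // mulr0.
rewrite sum2 !sum2 z1 ?setU11 // (z2 b b) ?setU11 // !add0r addr0.
rewrite [\sum_(w in W) _ * dot (phi a - _) _]big1 ?addr0; last first.
  by move=> w hw; rewrite z1 ?setU11 // inE hw orbT.
rewrite [\sum_(w in W) _ * dot (phi b - _) _]big1 ?addr0; last first.
  by move=> w hw; rewrite z2 ?setU11 // inE hw orbT.
rewrite [\sum_(w in W) _]big1 ?addr0; last first.
  move=> w hw; rewrite sum2 big1; last by move=> y hy; rewrite z1 // inE ?hw ?hy orbT.
  by rewrite z1 ?z2 ?setU11 ?addr0 // inE hw orbT.
rewrite (mulrC (l b)) -[phi b - phi a]opprB -[mu b - mu a]opprB dotNl dotNr opprK.
rewrite -mulr2n lb mulr1 => /eqP; rewrite mulrn_eq0 /= mulf_eq0 => /orP [|/eqP //].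
(* If [l a] vanished, b would be an affine combination of W alone, against the independence of the
   spokes from b to W. *)
rewrite la subr_eq0 => /eqP hs1.
have hbs : \sum_(w in W) c w *: (phi w - phi b) = 0.
  under eq_bigr => w _ do rewrite scalerBr.
  by rewrite sumrB -scaler_suml -/s hs hs1 !scale1r subrK subrr.
have hc0 := spokes_indep hbW (eq_leq hW) hbs.
by move: hs1; rewrite /s big1 // => /eqP; rewrite eq_sym oner_eq0.
Qed.

(** A vertex of U1, a vertex of U2 and d common vertices form the configuration of
    [length_implied]. *)
Lemma rigid_glue E U1 U2 : (d <= #|U1 :&: U2|)%N ->
  rigid phi E U1 -> rigid phi E U2 -> rigid phi E (U1 :|: U2).
Proof.
move=> /subset_of_card [W /subsetP hW cW] h1 h2 mu hmu.
have key a b : a \in U1 -> b \in U2 -> dot (phi a - phi b) (mu a - mu b) = 0.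
  move=> ha hb.
  have [ha2|ha2] := boolP (a \in U2); first exact: h2.
  have [hb1|hb1] := boolP (b \in U1); first exact: h1.
  apply: (length_implied (W := W)) => //.
  - by apply: contra ha2 => /hW; rewrite inE => /andP [].
  - by apply: contra hb1 => /hW; rewrite inE => /andP [].
  - by move=> x y /setU1P [->|/hW/setIP [? ?]] /setU1P [->|/hW/setIP [? ?]]; apply: h1.
  - by move=> x y /setU1P [->|/hW/setIP [? ?]] /setU1P [->|/hW/setIP [? ?]]; apply: h2.
move=> a b /setUP [ha|ha] /setUP [hb|hb]; [exact: h1|exact: key| |exact: h2].
by rewrite -opprB -[mu a - mu b]opprB dotNl dotNr opprK; apply: key.
Qed.

End GenericRigidity.

(** * Rank of the complete graph *)

Section Count.
Variables (R : realFieldType) (V : finType) (d : nat) (phi : V -> 'rV[R]_d).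
Hypothesis phi_gen : generic_embedding phi.
Implicit Types (mu psi : V -> 'rV[R]_d) (E : {set {set V}}) (U S W : {set V}) (u v a b : V).

(* For |W| = d these edges form a basis of the generic rigidity matroid on U. *)
Definition base_edges U W : {set {set V}} := [set e in pairs U | e :&: W != set0].

Lemma base_edges_is_graph U W : is_graph (base_edges U W).
Proof. by move=> e; rewrite inE => /andP [/pairs_is_graph]. Qed.

Lemma rigid_base_edges U W : W \subset U -> #|W| = d -> rigid phi (base_edges U W) U.
Proof.
move=> /subsetP hWU cW mu hmu.
have key a b : a \in U -> b \in U -> (a \in W) || (b \in W) ->
    dot (phi a - phi b) (mu a - mu b) = 0.
  move=> ha hb hab; have [->|nab] := eqVneq a b; first by rewrite !subrr dot0l.
  apply: hmu => //; rewrite inE in_pairs // ha hb /=; apply/set0Pn.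
  by case/orP: hab => h; [exists a|exists b]; rewrite !inE h eqxx ?orbT.
have star a x y : a \in U -> x \in a |: W -> y \in a |: W ->
    dot (phi x - phi y) (mu x - mu y) = 0.
  move=> ha /setU1P [->|hx] /setU1P [->|hy]; first by rewrite !subrr dot0l.
  - by apply: key; rewrite // ?hy ?orbT ?(hWU _ hy).
  - by apply: key; rewrite // ?hx ?(hWU _ hx).
  by apply: key; rewrite // ?hx ?(hWU _ hx) ?(hWU _ hy).
move=> a b ha hb; have [h|] := boolP ((a \in W) || (b \in W)); first exact: key.
rewrite negb_or => /andP [haW hbW].
by apply: (length_implied phi_gen haW hbW cW) => x y; apply: star.
Qed.

(** A row dependency is a self-stress. At a vertex outside W it lives on spokes into W, which are
    independent. With those edges gone, a vertex of W keeps fewer than d spokes, again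
    independent. *)
Lemma base_edges_free U W : #|W| = d -> row_free (bar_mx (base_edges U W) (bars phi)).
Proof.
move=> cW; apply: inj_row_free => c hc.
pose e (i : 'I_#|base_edges U W|) : {set V} := enum_val i.
pose g a u := \sum_(i | (a \in e i) && (u \in e i)) c 0 i.
have gC a u : g a u = g u a by apply: eq_bigl => i; rewrite andbC.
have eP i a b : a != b -> a \in e i -> b \in e i -> e i = [set a; b].
  move=> hab ha hb; apply/esym/eqP; rewrite eqEcard subUset !sub1set ha hb /=.
  by rewrite cards2 hab (base_edges_is_graph (enum_valP i)).
have g0 a u : a != u -> a \notin W -> u \notin W -> g a u = 0.
  move=> hau ha hu; rewrite /g big_pred0 // => i; apply/negP => /andP [h1 h2].
  have := enum_valP i; rewrite -/(e i) inE (eP _ _ _ hau h1 h2) => /andP [_ /set0Pn [x]].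
  by rewrite !inE => /andP [/orP [] /eqP ->]; apply/negP.
(* The columns of a express equilibrium of the stress at a. *)
have col a : \sum_(u | u != a) g a u *: (phi u - phi a) = 0.
  apply/matrixP => z k; rewrite ord1 [RHS]mxE summxE.
  have := congr1 (fun M : 'rV_ _ => M 0 (enum_rank (a, k))) hc.
  rewrite !mxE => h; apply: oppr_inj; rewrite oppr0 -[RHS]h -sumrN.
  transitivity (\sum_(u | u != a) \sum_(i | (a \in e i) && (u \in e i)) c 0 i * (phi a - phi u) 0
    k).
    apply: eq_bigr => u _; rewrite -mulr_suml [X in - X]mxE -mulrN; congr (_ * _).
    by rewrite !mxE opprB.
  rewrite (exchange_big_dep predT) //=; apply: eq_bigr => i _.
  rewrite mxE /= enum_rankK /= -/(e i); case: ifP => hai;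
    last by rewrite big_pred0 ?mulr0 // => u; rewrite andbF.
  rewrite mulr_sumr; apply: eq_bigl => u; by rewrite !inE.
have gout a u : a \notin W -> u != a -> g a u = 0.
  move=> ha; have hs : \sum_(u in W) g a u *: (phi u - phi a) = 0.
    rewrite -[RHS](col a) [RHS](bigID (mem W)) /= [X in _ + X]big1 ?addr0.
      by apply: eq_bigl => w; case: eqP => [->|//]; rewrite (negPf ha).
    by move=> w /andP [hwa hw]; rewrite g0 ?scale0r // eq_sym.
  have [hu _|hu hua] := boolP (u \in W); last by rewrite g0 // eq_sym.
  exact: (spokes_indep phi_gen ha (eq_leq cW) hs).
have gall a u : u != a -> g a u = 0.
  have [ha|ha] := boolP (a \in W); last exact: gout.
  have [hu hua|hu hua] := boolP (u \in W); last by rewrite gC gout // eq_sym.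
  have hs : \sum_(u in W :\ a) g a u *: (phi u - phi a) = 0.
    rewrite -[RHS](col a) [RHS](bigID (mem W)) /= [X in _ + X]big1 ?addr0.
      by apply: eq_bigl => w; rewrite !inE.
    by move=> w /andP [hwa hw]; rewrite gC gout ?scale0r // eq_sym.
  apply: (spokes_indep (S := W :\ a) phi_gen _ _ hs); rewrite ?inE ?eqxx ?hua //.
  by rewrite -cW subset_leq_card ?subD1set.
apply/matrixP => z i; rewrite ord1 [RHS]mxE.
have /eqP/cards2P [a [b [hab hi]]] := base_edges_is_graph (enum_valP i).
have := gall b a hab; rewrite /g (bigD1 i) /=; last by rewrite /e hi !inE !eqxx orbT.
rewrite big1 ?addr0 // => j /andP [/andP [h1 h2]]; case/eqP; apply: enum_val_inj.
by rewrite hi -/(e j) (eP _ _ _ hab h2 h1).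
Qed.

Lemma card_pairs U : #|pairs U| = 'C(#|U|, 2).
Proof. exact: cards_draws. Qed.

(** All pairs minus those avoiding W: C(n, 2) - C(n - d, 2) = dn - C(d + 1, 2). *)
Lemma card_base_edges U W : W \subset U -> #|W| = d ->
  (#|base_edges U W| + 'C(d.+1, 2) = d * #|U|)%N.
Proof.
move=> hWU cW; have -> : base_edges U W = pairs U :\: pairs (U :\: W).
  apply/setP => e; rewrite !inE subsetD -setI_eq0.
  by case: (e \subset U); case: (#|e| == 2%N); case: (_ == set0).
rewrite cardsDS; last by apply/subsetP => e; rewrite !inE subsetD -andbA => /and3P [-> _ ->].
rewrite !card_pairs cardsDS // cW; have := subnK (subset_leq_card hWU); rewrite cW => <-.
rewrite addnK; move: (#|U| - d)%N => m.
have h n : ('C(n.+1, 2) = 'C(n, 2) + n)%N by rewrite binS bin1.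
have h2 n k : ('C(n + k, 2) = 'C(n, 2) + 'C(k, 2) + n * k)%N.
  by elim: k => [|k IH]; [rewrite addn0 bin0n muln0 !addn0|rewrite addnS !h IH; lia].
have h3 n : ('C(n, 2) + 'C(n.+1, 2) = n * n)%N.
  by elim: n => [|n IH]; [|rewrite !h in IH *; lia].
by rewrite h2; have := h3 d; lia.
Qed.

Lemma rank_pairs U : (d <= #|U|)%N ->
  (\rank (bar_mx (pairs U) (bars phi)) + 'C(d.+1, 2) = d * #|U|)%N.
Proof.
move=> /subset_of_card [W hWU cW]; rewrite -(card_base_edges hWU cW).
have /eqP <- := base_edges_free U cW; congr (_ + _)%N; apply/eqP.
have aP := @bars_antisym R V d phi.
rewrite eqn_leq !mxrankS //;
  apply/(bar_mx_subP (@base_edges_is_graph U W) (@pairs_is_graph V U) aP aP) ||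
  apply/(bar_mx_subP (@pairs_is_graph V U) (@base_edges_is_graph U W) aP aP).
  by move=> mu h a b hab; rewrite inE => /andP [hp _]; apply: h.
exact/rigidP/rigid_base_edges.
Qed.

End Count.

(** * Vertex splitting *)

Section Split.
Variables (R : realFieldType) (V : finType) (d : nat) (phi : V -> 'rV[R]_d).
Hypothesis phi_gen : generic_embedding phi.
Implicit Types (mu psi : V -> 'rV[R]_d) (E : {set {set V}}) (U S W : {set V}) (u v a b : V).

(** Equations saying that u and v move alike. For u outside U they are independent of the rows of
    the complete graph on U, and account for the d new ranks of a vertex split. *)
Definition diff_mx u v : 'M[R]_(d, #|{: V * 'I_d}|) :=
  \matrix_(k, j) ((((enum_val j).1 == u)%:R - ((enum_val j).1 == v)%:R) * ((enum_val j).2 == k)%:R).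

Definition proj_vertex u : 'M[R]_(#|{: V * 'I_d}|, d) :=
  \matrix_(j, k) (((enum_val j).1 == u) && ((enum_val j).2 == k))%:R.

Lemma diff_mxM u v mu : diff_mx u v *m mcol mu = (mu u - mu v)^T.
Proof.
apply/matrixP => k z; rewrite !mxE (reindex (@enum_rank {: V * 'I_d})) /=;
  last exact/onW_bij/enum_rank_bij.
under eq_bigr => j _ do rewrite !mxE enum_rankK.
rewrite -(pair_bigA _ (fun w l => ((w == u)%:R - (w == v)%:R) * (l == k)%:R * mu w 0 l)) /=.
rewrite ord1 -[mu u 0 k]mulr1.
transitivity (\sum_w ((w == u)%:R * mu w 0 k - (w == v)%:R * mu w 0 k)).
  apply: eq_bigr => w _; rewrite (bigD1 k) //= eqxx big1 ?addr0 ?mulr1 ?mulrBl // => l /negPf ->.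
  by rewrite mulr0 mul0r.
rewrite sumrB (bigD1 u) //= eqxx big1 ?addr0; last by move=> w /negPf ->; rewrite mul0r.
rewrite (bigD1 v) //= eqxx big1 ?addr0; last by move=> w /negPf ->; rewrite mul0r.
by rewrite !mul1r mulr1.
Qed.

Lemma diff_proj u v : u != v -> diff_mx u v *m proj_vertex u = 1%:M.
Proof.
move=> huv; apply/matrixP => k z; rewrite !mxE (reindex (@enum_rank {: V * 'I_d})) /=;
  last exact/onW_bij/enum_rank_bij.
under eq_bigr => j _ do rewrite !mxE enum_rankK.
rewrite (bigD1 (u, z)) //= !eqxx (negPf huv) subr0 mul1r mulr1 big1 ?addr0 1?eq_sym //.
move=> [w l] /=; rewrite xpair_eqE; case: eqP => [->|]; case: eqP => //= *; by rewrite ?mulr0.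
Qed.

Lemma pairs_proj u U psi : u \notin U -> bar_mx (pairs U) (bars psi) *m proj_vertex u = 0.
Proof.
move=> hu; apply/matrixP => i z; rewrite !mxE big1 // => j _; rewrite !mxE /=.
case: eqP => [->|_]; last by rewrite mulr0.
have := enum_valP i; rewrite inE => /andP [/subsetP hs _].
by case: ifP => [/hs|_]; [rewrite (negPf hu)|rewrite mul0r].
Qed.

Lemma set2_cases a b u v : [set a; b] = [set u; v] -> (a = u /\ b = v) \/ (a = v /\ b = u).
Proof.
move=> h; have : a \in [set u; v] by rewrite -h !inE eqxx.
have : b \in [set u; v] by rewrite -h !inE eqxx orbT.
have : u \in [set a; b] by rewrite h !inE eqxx.
have : v \in [set a; b] by rewrite h !inE eqxx orbT.
by rewrite !inE; do 4![case/orP => /eqP ?]; subst; auto.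
Qed.

(* Special position: u is moved to v while the bar uv (if present) keeps its
   direction.  Letting u move back along that direction only increases the rank. *)
Lemma vertex_split E E' U u v S :
  E \subset pairs (u |: U) -> E' \subset pairs U -> u \notin U -> v \in U ->
  (d <= #|U|)%N -> rigid phi E' U ->
  (forall a b, a != b -> [set a; b] \in E' -> [set a; b] \notin E ->
     (a = v /\ [set u; b] \in E) \/ (b = v /\ [set u; a] \in E)) ->
  v \notin S -> #|S| = d ->
  (forall a, a \in S -> a != u -> [set u; a] \in E /\ [set v; a] \in E) ->
  (u \in S -> [set u; v] \in E) ->
  rigid phi E (u |: U).
Proof.
move=> hE hE' hu hv dU hrig hcon hvS cS hS huS.
have huv : u != v by apply: contraNneq hu => ->.
pose phi0 x := if x == u then phi v else phi x.
pose psi x := if x == u then phi u - phi v else 0.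
pose phit t x := phi0 x + t *: psi x.
pose isuv a b := [set a; b] == [set u; v].
pose dir0 a b := if isuv a b then phi a - phi b else phi0 a - phi0 b.
pose dir1 a b := if isuv a b then 0 else psi a - psi b.
pose dirt t a b := dir0 a b + t *: dir1 a b.
have isuvC a b : isuv a b = isuv b a by rewrite /isuv setUC.
have gE : is_graph E by move=> e /(subsetP hE)/pairs_is_graph.
have a0 : antisym dir0 by move=> a b; rewrite /dir0 isuvC; case: ifP; rewrite opprB.
have a1 : antisym dir1 by move=> a b; rewrite /dir1 isuvC; case: ifP; rewrite ?oppr0 ?opprB.
have at_ t : antisym (dirt t) by move=> a b; rewrite /dirt a0 a1 scalerN opprD.
have ab (p : V -> 'rV[R]_d) : antisym (bars p) := @bars_antisym R V d p.
have Ebar t : bar_mx E (dirt t) = bar_mx E dir0 + t *: bar_mx E dir1.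
  apply/matrixP => i j; rewrite !mxE /=; case: ifP => _; last by rewrite mulr0 addr0.
  by rewrite mulr_sumr -big_split; apply: eq_bigr => w _; rewrite !mxE.
have phi0u : phi0 u = phi v by rewrite /phi0 eqxx.
have phi0n x : x != u -> phi0 x = phi x by rewrite /phi0 => /negPf ->.
(* For nonzero t the placement [phit t] has differences [dirt t], except on uv, where its difference
   is t times the prescribed direction. *)
have st t : t != 0 -> (bar_mx E (dirt t) <= bar_mx E (bars (phit t)))%MS.
  move=> t0; apply/bar_mx_subP => // mu hmu a b hab he.
  have := hmu a b hab he; rewrite /bars /dirt /dir0 /dir1; case: ifP => [|_].
    move=> h; have -> : phit t a - phit t b = t *: (phi a - phi b).
      rewrite /phit /phi0 /psi; case: (set2_cases (eqP h)) => [[-> ->]|[-> ->]].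
        by rewrite eqxx eq_sym (negPf huv) scaler0 addr0 addrAC subrr add0r.
      by rewrite eqxx eq_sym (negPf huv) scaler0 addr0 opprD addNKr -scalerN opprB.
    by rewrite scaler0 addr0 dotZl => /eqP; rewrite mulf_eq0 (negPf t0) => /eqP.
  by rewrite /phit scalerBr opprD addrACA.
(* At t = 0 a motion has [mu u = mu v] and respects every bar of E', hence all lengths in U; so the
   rows of K and of [diff_mx u v] are in the row space. *)
have special : (\rank (bar_mx (pairs U) (bars phi)) + d <= \rank (bar_mx E dir0))%N.
  set K := bar_mx _ _.
  have -> : (\rank K + d = \rank (col_mx K (diff_mx u v)))%N.
    rewrite -addsmxE mxrank_disjoint_sum.
      congr (_ + _)%N; apply/esym/eqP; rewrite -/(row_free _); apply/row_freeP.
      by exists (proj_vertex u); rewrite diff_proj.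
    apply/eqP/rowV0P => x; rewrite sub_capmx => /andP [/submxP [y hy] /submxP [z hz]].
    have : x *m proj_vertex u = z by rewrite hz -mulmxA diff_proj // mulmx1.
    by rewrite hy -mulmxA pairs_proj // mulmx0 => h; rewrite -hy hz -h mul0mx.
  apply/mxrankS/submx_kerP => x; have [mu ->] := mcol_ex x.
  move=> /(motionP mu gE a0) hmu.
  have muE : mu u = mu v.
    apply/eqP; rewrite -subr_eq0; apply/eqP.
    (* For a other than u, the bars ua and va have the same direction from the common point, so
       their difference makes [mu u - mu v] orthogonal to it. The bar uv adds its own direction when
       u is in S. *)
    apply: (spokes_orth phi_gen hvS cS) => a ha.
    have [ea|na] := eqVneq a u.
      by rewrite ea in ha *; have := hmu u v huv (huS ha); rewrite /dir0 /isuv eqxx.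
    have [h1 h2] := hS a ha na.
    have nav : a != v by apply: contraNneq hvS => <-.
    have nuv1 : isuv v a = false.
      by apply/negP => /eqP/set2_cases [[e]|[_ e]]; rewrite ?e ?eqxx in na huv.
    have nuv2 : isuv u a = false.
      by apply/negP => /eqP/set2_cases [[_ e]|[e]]; rewrite ?e ?eqxx in nav huv.
    have nva : v != a by rewrite eq_sym.
    have nua : u != a by rewrite eq_sym.
    have nvu : v != u by rewrite eq_sym.
    have := hmu v a nva h2; rewrite /dir0 nuv1 !phi0n // => e1.
    have := hmu u a nua h1; rewrite /dir0 nuv2 phi0u phi0n // => e2.
    have -> : mu u - mu v = (mu u - mu a) - (mu v - mu a) by rewrite opprB addrA subrK.
    by rewrite -opprB dotNl dotBr e1 e2 subrr oppr0.
  rewrite mul_col_mx diff_mxM muE subrr trmx0.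
  have -> : K *m mcol mu = 0; last by rewrite col_mx0.
  apply/(motionP mu (@pairs_is_graph V U) (ab phi)).
  apply: (proj1 (@rigidP _ _ _ phi E' U) hrig).
  move=> a b hab he'.
  have hU := subsetP hE' _ he'; rewrite in_pairs // in hU; have /andP [haU hbU] := hU.
  have nau : a != u by apply: contraNneq hu => <-.
  have nbu : b != u by apply: contraNneq hu => <-.
  have nuv p q : p != u -> q != u -> isuv p q = false.
    by move=> hx hy; apply/negP => /eqP/set2_cases [[e]|[_ e]]; rewrite e eqxx in hx hy.
  have [he|hne] := boolP ([set a; b] \in E).
    by have := hmu a b hab he; rewrite /dir0 nuv // !phi0n.
  have side y : y != u -> y != v -> [set u; y] \in E -> dot (phi v - phi y) (mu v - mu y) = 0.
    move=> hx hxv hex; have hux : u != y by rewrite eq_sym.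
    have := hmu u y hux hex.
    rewrite /dir0 phi0u phi0n // muE; case: ifP => // /eqP/set2_cases [[_ e]|[e]];
      first by rewrite e eqxx in hxv.
    by rewrite e eqxx in huv.
  have [[ea hex]|[eb hex]] := hcon a b hab he' hne.
    by rewrite ea in hab *; apply: side; rewrite // eq_sym.
  rewrite eb in hab *; rewrite /bars -opprB -[mu a - _]opprB dotNl dotNr opprK.
  by apply: side.
have [t t0 ht] := pencil_rank (bar_mx E dir0) (bar_mx E dir1) (@mulrIn _ _ (oner_neq0 R)).
(* A new vertex raises the rank of the complete graph by exactly d, the gain already attained in
   special position. *)
have rk : (\rank (bar_mx (pairs (u |: U)) (bars phi)) <= \rank (bar_mx E (bars phi)))%N.
  have h1 := rank_pairs phi_gen dU.
  have h2 := rank_pairs phi_gen (leq_trans dU (subset_leq_card (subsetUr [set u] U))).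
  have h3 := generic_rig_rank phi_gen (phit t) E.
  rewrite !rig_mxE in h3; apply: leq_trans h3; apply: leq_trans (mxrankS (st t t0)).
  rewrite Ebar; apply: leq_trans ht; apply: leq_trans special.
  rewrite cardsU1 hu mulnDr muln1 -h1 in h2.
  by rewrite -(leq_add2r 'C(d.+1, 2)) h2 addnA (addnC d).
have sub : (bar_mx E (bars phi) <= bar_mx (pairs (u |: U)) (bars phi))%MS.
  apply/(bar_mx_subP (@pairs_is_graph V _) gE) => // mu hmu a b hab /(subsetP hE); exact: hmu.
apply/rigidP; apply/(bar_mx_subP gE (@pairs_is_graph V _)) => //.
by rewrite -(geq_leqif (mxrank_leqif_sup sub)).
Qed.

End Split.

(** * Rigidity of minimal cycles *)

Section Fogelsanger.
Variables (R : realFieldType) (V : finType) (d : nat) (phi : V -> 'rV[R]_d).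
Hypothesis phi_gen : generic_embedding phi.
Implicit Types (E C L : {set {set V}}) (U S T s : {set V}) (u v a b : V).

(** The faces [s :\ u] and [s :\ v] lie in simplices of L, so the other vertices of T and s are
    common neighbours of u and v, as vertex splitting requires. *)
Lemma hinge_nbr r T L u v s a : u != v -> half_cycle r u v L -> s \in hinge r u v L ->
  a \in T :|: s -> a != u -> a != v ->
  [set u; a] \in join_graph T L /\ [set v; a] \in join_graph T L.
Proof.
move=> huv hL hs ha au av.
have := hs; rewrite inE => /and4P [_ su sv _].
have h x y : (y == u) || (y == v) -> x != y -> x \in s -> a != y -> x != a -> [set x;
  a] \in join_graph T L.
  move=> hy xy xs ay xa; have [s' hs' /subsetP hss'] := hinge_sub hL hs hy.
  apply: (join_graph_pair (s := s')); rewrite // !inE ?(hss' x) ?orbT // ?inE ?xy //.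
  by move: ha; rewrite inE => /orP [->//|ha]; rewrite (hss' a) ?orbT // !inE ay.
split.
- by apply: (h u v); rewrite ?eqxx ?orbT // eq_sym.
- by apply: (h v u); rewrite ?eqxx // eq_sym.
Qed.

(** X is empty or the single bar uv, so that one statement serves splits with this bar and without
    it. Only when the bar is present may u belong to S, standing for the direction of uv. *)
Lemma split_step r T L u v s (X : {set {set V}}) S :
  u != v -> (#|T| + r = d)%N -> [disjoint T & vert L] -> half_cycle r u v L -> s \in hinge r u v
    L ->
  rigid phi (join_graph T (contract u v @: L)) (T :|: vert (contract u v @: L)) ->
  X \subset [set [set u; v]] -> v \notin S -> #|S| = d ->
  (forall a, a \in S -> a != u -> [set u; a] \in join_graph T L /\ [set v; a] \in join_graph T L) ->
  (u \in S -> [set u; v] \in X) ->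
  rigid phi (join_graph T L :|: X) (T :|: (u |: (v |: vert L))).
Proof.
move=> huv hr hT hL hs hrig hX hvS cS hS huS.
have := hs; rewrite inE => /and4P [_ su sv _].
have [s1 hs1 /subsetP hss1] : exists2 s', s' \in L & s :\ v \subset s' by apply: (hinge_sub hL
  hs); rewrite eqxx orbT.
have [s2 hs2 /subsetP hss2] : exists2 s', s' \in L & s :\ u \subset s' by apply: (hinge_sub hL
  hs); rewrite eqxx.
have us1 : u \in s1 by apply: hss1; rewrite !inE huv.
have vs2 : v \in s2 by apply: hss2; rewrite !inE eq_sym huv.
have inT x s' : s' \in L -> x \in s' -> x \notin T.
  move=> hs' hx; apply/negP => xT; move/pred0P/(_ x): hT => /=; rewrite xT /=.
  by move/negP; apply; apply/vertP; exists s'.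
have uT := inT _ _ hs1 us1; have vT := inT _ _ hs2 vs2.
have vc : v \in contract u v s1 by rewrite /contract us1 setU11.
have cU s' : s' \in L -> contract u v s' \subset vert (contract u v @: L).
  by move=> hs'; apply: vert_sup; apply: imset_f.
have vU : v \in vert (contract u v @: L) by apply: (subsetP (cU _ hs1)).
have sub x s' : s' \in L -> x \in s' -> x \in u |: vert (contract u v @: L).
  move=> hs' hx; rewrite inE; have [->|xu] := eqVneq x u; first by rewrite inE eqxx.
  by rewrite (subsetP (cU _ hs')) ?orbT // /contract; case: ifP => // _; rewrite !inE xu hx orbT.
have vertS : vert L \subset u |: vert (contract u v @: L).
  by apply/subsetP => x /vertP [s' hs' hx]; apply: (sub x s').
apply: (@rigid_mono _ _ _ phi _ _ (u |: (T :|: vert (contract u v @: L)))) (subxx _) _ _.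
  apply/subsetP => x; rewrite !inE => /or4P [->|->|/eqP ->|/(subsetP vertS)]; rewrite ?vU ?orbT //.
  by rewrite !inE => /orP [->|->]; rewrite ?orbT.
apply: (vertex_split phi_gen (E' := join_graph T (contract u v @: L)) (S := S) (v := v)) => //.
- apply/subsetP => e; rewrite inE => /orP [/join_graphP [ce [s' hs' /subsetP he]]|/(subsetP hX)].
    rewrite inE ce eqxx andbT; apply/subsetP => x /he; rewrite !inE => /orP [->|/(sub _ _ hs')];
      rewrite ?orbT //.
    by rewrite !inE => /orP [->|->]; rewrite ?orbT.
  by rewrite inE => /eqP ->; rewrite in_pairs // !inE eqxx vU !orbT.
- apply/subsetP => e /join_graphP [ce [s' hs' he]]; rewrite inE ce eqxx andbT.
  by apply: (subset_trans he); apply: setUS; apply: vert_sup.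
- rewrite inE negb_or uT; apply/negP => /vertP [q /imsetP [s' _ ->]].
  by apply/negP; apply: contract_notin.
- by rewrite inE vU orbT.
- rewrite -hr -(card_contract hL hs1); apply: leq_trans (subset_leq_card (setUS T (cU _ hs1))).
  rewrite cardsU [X in (_ - X)%N](_ : _ = 0%N) ?subn0 //.
  apply/eqP; rewrite cards_eq0; apply/eqP/setP => x; rewrite in_set0 in_setI;
    apply/negP => /andP [xT].
  rewrite /contract us1 !inE => /orP [/eqP e|/andP [_ h]]; first by rewrite e (negPf vT) in xT.
  by rewrite (negPf (inT _ _ hs1 h)) in xT.
(* An edge of the contraction that L lacks comes from a simplex through u, with u renamed v. *)
- move=> a b hab /join_graphP [_ [q /imsetP [s' hs' ->]]];
  rewrite subUset !sub1set inE => /andP [ha hb] hne.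
  have nskel : [set a; b] \notin join_graph T L by apply: contra hne => h; rewrite inE h.
  have us' : u \in s'.
    by apply: contraNT nskel => us'; move: ha hb;
      rewrite /contract (negPf us') -in_setU => ha hb; apply: (join_graph_pair hab hs').
  have inc x : x \in T :|: contract u v s' -> x != v -> x \in T :|: s' /\ x != u.
    rewrite /contract us' !inE => /or3P [xT|->//|/andP [->]]; last by move=> ->; rewrite orbT.
    by move=> _; rewrite xT; split => //; apply: contraNneq uT => <-.
  rewrite -in_setU in ha.
  have [av|av] := eqVneq a v; [left|have [bv|bv] := eqVneq b v; [right|]].
  + have [|hb' bu] := inc b hb; first by rewrite -av eq_sym.
    by split => //; rewrite inE (join_graph_pair _ hs') // 1?eq_sym // !inE us' orbT.
  + have [|ha' au] := inc a ha; first by [].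
    by split => //; rewrite inE (join_graph_pair _ hs') // 1?eq_sym // !inE us' orbT.
  + have [ha' _] := inc a ha av; have [hb' _] := inc b hb bv.
    by rewrite (join_graph_pair hab hs') in nskel.
- by move=> a aS au; have [h1 h2] := hS a aS au; rewrite !in_setU h1 h2.
- by move=> uS; rewrite inE huS ?orbT.
Qed.

Lemma hinge_vert r L u v s : u != v -> half_cycle r u v L -> s \in hinge r u v L -> s \subset
  vert L.
Proof.
move=> huv hL hs; apply/subsetP => x hx; have [xv|xv] := eqVneq x v.
  have [s' hs' /subsetP h] : exists2 s', s' \in L & s :\ u \subset s' by apply: (hinge_sub hL
    hs); rewrite eqxx.
  by apply/vertP; exists s' => //; apply: h; rewrite !inE hx xv eq_sym huv.
have [s' hs' /subsetP h] : exists2 s', s' \in L & s :\ v \subset s' by apply: (hinge_sub hL hs);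
  rewrite eqxx orbT.
by apply/vertP; exists s' => //; apply: h; rewrite !inE hx xv.
Qed.

(** A cancelling pair cannot be contracted, but with uv added its join with T has a complete graph.
    Any other piece is recovered from its contraction by a split that uses the bar uv. *)
Lemma piece_rigid r T L u v s : u != v -> (3 <= r)%N -> (#|T| + r = d)%N -> [disjoint T & vert L] ->
  irreducible r u v L -> s \in hinge r u v L ->
  (~~ has_pair u v L -> rigid phi (join_graph T (contract u v @: L)) (T :|: vert (contract u v @:
    L))) ->
  rigid phi ([set u; v] |: join_graph T L) (T :|: (u |: (v |: vert L))).
Proof.
move=> huv r3 hr hT hirr hs hrig; have [hL _] := hirr.
have dT (A : {set V}) : A \subset vert L -> [disjoint T & A].
  by move=> hA; exact: (disjointWr hA hT).
have [hp|hp] := boolP (has_pair u v L).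
  have [q [uq vq eL]] := irreducible_pair huv hirr hp.
  apply: (rigid_mono _ (subxx _) (@rigid_pairs _ _ _ phi _)).
  apply/subsetP => e; rewrite inE => /andP [/subsetP he ce]; rewrite in_setU in_set1.
  have vL x : x \in vert L -> [|| x == u, x == v | x \in q].
    by move=> /vertP [s']; rewrite eL !inE => /orP [] /eqP ->; rewrite !inE => /orP [->|->];
      rewrite ?orbT.
  have he2 x : x \in e -> [|| x \in T, x == u, x == v | x \in q].
    by move=> /he; rewrite !inE => /or4P [->|->|->|/vL]; rewrite ?orbT // => ->; rewrite orbT.
  have [ue|ue] := boolP (u \in e); last first.
    rewrite [X in _ || X](_ : _ = true) ?orbT //; apply/join_graphP; split; first exact/eqP.
    exists (v |: q); first by rewrite eL set22.
    apply/subsetP => x xe; have := he2 x xe; have : x != u by apply: contraNneq ue => <-.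
    by rewrite !inE => /negPf ->.
  have [ve|ve] := boolP (v \in e); last first.
    rewrite [X in _ || X](_ : _ = true) ?orbT //; apply/join_graphP; split; first exact/eqP.
    exists (u |: q); first by rewrite eL set21.
    apply/subsetP => x xe; have := he2 x xe; have : x != v by apply: contraNneq ve => <-.
    by rewrite !inE => /negPf ->.
  by rewrite inE eq_sym eqEcard subUset !sub1set ue ve (eqP ce) cards2 huv.
have [y [ys [s' hs' ys']]] := hinge_common huv hL r3 hs.
have := hs; rewrite inE => /and4P [/eqP cs su sv _].
have vs := hinge_vert huv hL hs; have vs' := hinge_vert huv hL hs'.
have yT : y \notin T.
  by apply/negP => yT; move/pred0P/(_ y): hT => /=; rewrite yT (subsetP vs').
have vT : v \notin T.
  by apply/negP => vT; move/pred0P/(_ v): hT => /=; rewrite vT (subsetP vs).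
have yv : y != v by apply: contraNneq ys => ->.
(* The d directions: the vertices of T, the r - 2 vertices of s besides u and v, the extra neighbour
   y, and the bar uv represented by u. *)
rewrite setUC; apply: (split_step (s := s) (S := T :|: (y |: s :\ v)) huv hr hT hL hs (hrig hp))
  => //.
- by rewrite !inE (negPf vT) eqxx eq_sym (negPf yv).
- have : [disjoint T & y |: s :\ v].
    by apply: dT; rewrite subUset sub1set (subsetP vs') // (subset_trans (subsetDl _ _) vs).
  rewrite -leq_card_setU => /eqP ->.
  by rewrite cardsU1 !inE (negPf ys) andbF -hr -cs (cardsD1 v s) sv.
- move=> a; rewrite in_setU in_setU1 in_setD1 => /or3P [aT|/eqP ->|/andP [av ha]] au.
  + apply: (hinge_nbr huv hL hs); rewrite // ?inE ?aT //.
    by apply: contraNneq vT => <-.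
  + by apply: (hinge_nbr huv hL hs'); rewrite // ?inE ?ys' ?orbT.
  + by apply: (hinge_nbr huv hL hs); rewrite // ?inE ?ha ?orbT.
- by move=> _; rewrite inE.
Qed.

Theorem fogelsanger r T C : (3 <= r)%N -> (#|T| + r = d)%N -> [disjoint T & vert C] ->
  minimal_cycle r C -> rigid phi (join_graph T C) (T :|: vert C).
Proof.
move=> r3 hr; have [n] := ubnP #|vert C|; elim: n C => // n IH C;
  rewrite ltnS => hn hT [hC C0 hmin].
have /is_cycleP [cC _] := hC.
have [s0 hs0] := set0Pn _ C0.
have [u [v [us vs huv]]] : exists u v, [/\ u \in s0, v \in s0 & u != v].
  have : (1 < #|s0|)%N by rewrite (cC _ hs0); lia.
  by case/card_gt1P => u [v [? ? ?]]; exists u, v.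
pose X0 := off_edge u v C.
have gX : half_cycle r u v X0 by apply: off_edge_half_cycle.
have XC : X0 \subset C by apply: off_edgeS.
have dT L : L \subset C -> [disjoint T & vert L].
  by move=> hL; apply: (disjointWr _ hT); apply/bigcupsP => s hs; apply: vert_sup;
    apply: (subsetP hL).
have uvE : [set u; v] \in join_graph T C by apply: (join_graph_pair huv hs0);
  rewrite inE ?us ?vs orbT.
pose W L := T :|: (u |: (v |: vert L)).
have piece L s : L \subset X0 -> irreducible r u v L -> s \in hinge r u v L -> rigid phi
  (join_graph T C) (W L).
  move=> hLX hirr hs; have [hL _] := hirr.
  have hLC := subset_trans hLX XC.
  apply: (rigid_mono _ _ (piece_rigid huv r3 hr (dT _ hLC) hirr hs _)); last first.
  - move=> hp; have L0 : L != set0.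
      have [|s' hs' _] := hinge_sub (x := u) hL hs; first by rewrite eqxx.
      by apply/set0Pn; exists s'.
    have vsub : vert (contract u v @: L) \subset vert C :\ u.
      apply/subsetP => x /vertP [q /imsetP [s' hs' ->]] hx; rewrite in_setD1.
      have -> : x != u by apply: contraTneq hx => ->; apply: contract_notin.
      have hs'C := subsetP hLC _ hs'.
      move: hx; rewrite /contract; case: ifP => _; last by move=> hx; apply/vertP; exists s'.
      by rewrite !inE => /orP [/eqP ->|/andP [_ hx]]; apply/vertP; [exists s0|exists s'].
    apply: IH; last exact: contract_minimal_cycle.
      apply: leq_trans hn; apply: (@leq_ltn_trans #|vert C :\ u|); first exact: subset_leq_card.
      by rewrite [X in (_ < X)%N](cardsD1 u) [u \in _](_ : _ = true) //; apply/vertP; exists s0.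
    by apply: (disjointWr _ hT); apply: subset_trans vsub (subsetDl _ _).
  - exact: subxx.
  - by rewrite subUset sub1set uvE join_graphS.
(* A is the part of X0 already glued together; m bounds what remains. *)
suff grow m A : (#|X0 :\: A| < m)%N -> A \subset X0 -> half_cycle r u v A -> A != set0 ->
    rigid phi (join_graph T C) (W A) -> rigid phi (join_graph T C) (T :|: vert C).
  have s0h : s0 \in hinge r u v X0 by rewrite hinge_off_edge // hs0 us vs.
  have [L [hLX hirr hs]] := irreducible_ex gX s0h; have [hL _] := hirr.
  apply: (grow _ L (ltnSn _) hLX hL _ (piece _ _ hLX hirr hs)).
  have [|s' hs' _] := hinge_sub (x := u) hL hs; first by rewrite eqxx.
  by apply/set0Pn; exists s'.
elim: m A => // m IHm A; rewrite ltnS => hm hAX hA A0 hrA.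
have [eA|neA] := eqVneq A X0.
  apply: (rigid_mono (subxx _) _ hrA); apply: setUS; rewrite eA.
  apply/subsetP => x /vertP [s hs hx].
  have : s \in fill r u v X0 by rewrite off_edge_fill.
  rewrite /fill [s \in _]in_setU => /orP [hs'|hs'].
    by rewrite !inE (subsetP (vert_sup hs')) ?orbT.
  by rewrite !inE (subsetP (hinge_vert huv gX hs')) ?orbT.
have pA := fill_cycle huv hA.
(* Were the filling of A inside C, minimality would make it C, and A all of X0. So some hinge
   simplex q of A is not in C; the rest of X0 must then have q in its hinge too, and T with q gives
   d shared vertices. *)
have [q hqA hqC] : exists2 q, q \in hinge r u v A & q \notin C.
  have [h|/subsetPn [q]] := boolP (fill r u v A \subset C).
    case: (hmin _ h pA) => e.
      by case/set0Pn: A0 => s hs; have := subsetP (subsetUl A (hinge r u v A)) _ hs;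
        rewrite -/(fill r u v A) e inE.
    case/eqP: neA; apply/eqP; rewrite eqEsubset hAX; apply/subsetP => s hs.
    have := subsetP XC _ hs; rewrite -[in X in X -> _]e /fill in_setU => /orP [//|];
      rewrite inE => /and4P [_ a b _].
    by move: hs; rewrite inE a b andbF.
  rewrite /fill in_setU => /orP [hq|hq] nq; last by exists q.
  by rewrite (subsetP (subset_trans hAX XC)) in nq.
have hqB : q \in hinge r u v (X0 :\: A) by rewrite in_hingeD // hqA hinge_off_edge // (negPf hqC).
have [L [hLB hirr hqL]] := irreducible_ex (half_cycleD hAX gX hA) hqB; have [hL _] := hirr.
have hLX : L \subset X0 := subset_trans hLB (subsetDl _ _).
have dAL : [disjoint A & L].
  by rewrite disjoint_sym; apply: (disjointWl hLB); rewrite disjoints_subset;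
    apply/subsetP => s; rewrite !inE => /andP [].
apply: (IHm (A :|: L)).
- apply: leq_trans hm; apply: proper_card; apply/properP; split.
    by apply: setDS; apply: subsetUl.
  have [|s' hs' _] := hinge_sub (x := u) hL hqL; first by rewrite eqxx.
  by exists s'; [apply: (subsetP hLB)|rewrite !inE hs' orbT].
- by rewrite subUset hAX.
- exact: half_cycleU.
- by case/set0Pn: A0 => s hs; apply/set0Pn; exists s; rewrite inE hs.
have glue := rigid_glue phi_gen (E := join_graph T C) (U1 := W A) (U2 := W L) _ hrA (piece _ _
  hLX hirr hqL).
apply: (rigid_mono (subxx _) _ (glue _)).
  apply/subsetP => x; rewrite !inE => /or4P [->|->|->|]; rewrite ?orbT //.
  by move=> /vertP [s]; rewrite in_setU => /orP [hs|hs] hx;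
    rewrite (subsetP (vert_sup hs) x hx) ?orbT.
have qL := hinge_vert huv hL hqL; have qA := hinge_vert huv hA hqA.
have cq : #|T :|: q| = d.
  have : [disjoint T & q] by apply: (disjointWr _ (dT _ (subset_trans hLX XC))).
  by rewrite -leq_card_setU => /eqP ->; rewrite -hr; move: hqA; rewrite inE => /andP [/eqP ->].
rewrite -[X in (X <= _)%N]cq; apply/subset_leq_card/subsetP => x; rewrite !inE.
by case/orP => [->//|hx]; rewrite (subsetP qL) ?(subsetP qA) ?orbT.
Qed.

End Fogelsanger.

Local Close Scope ring_scope.

(** * Facets of a homology sphere *)

Section Topology.
Variables (F : fieldType) (V : finType).
Implicit Types (D K C Z : {set {set V}}) (s t : {set V}).

Lemma bd_sign_pair (x y : V) : x != y ->
  (bd_sign F [set x; y] x + bd_sign F [set x; y] y = 0)%R.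
Proof.
move=> hxy.
have h (a b : V) : a != b -> #|[set w in [set a;
  b] | (enum_rank w < enum_rank a)%N]| = (enum_rank b < enum_rank a)%N.
  move=> hab; rewrite -sum1_card (eq_bigl (fun w => (w \in [set a;
    b]) && (enum_rank w < enum_rank a)%N)); last by move=> w; rewrite inE.
  by rewrite big_mkcondr big_setU1 ?inE //= big_set1 ltnn add0n; case: ifP.
rewrite /bd_sign h // setUC h 1?eq_sym //.
have : enum_rank x != enum_rank y by rewrite (inj_eq enum_rank_inj).
rewrite -val_eqE /= neq_ltn => /orP [] e; rewrite e ltnNge (ltnW e) /= expr0 expr1.
  by rewrite subrr.
by rewrite addNr.
Qed.

Lemma rank_bd1 K : (\rank (bd_mx F K 1) <= 1)%N.
Proof.
apply: leq_trans (rank_leq_col _) _; rewrite -[X in (_ <= X)%N](cards1 (set0 : {set V})).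
by apply/subset_leq_card/subsetP => s /setIdP [_ /eqP/cards0_eq ->]; rewrite inE.
Qed.

(* The indicators of two separated parts are independent 0-cocycles. *)
Lemma rbetti_disconnected K (P : pred V) a b :
  (forall s t : {set V}, s \in K -> t \subset s -> t \in K) ->
  (forall x y, x != y -> [set x; y] \in K -> P x = P y) ->
  [set a] \in K -> [set b] \in K -> P a -> ~~ P b -> rbetti F K 1 <> 0%N.
Proof.
move=> hK hP ha hb Pa Pb.
pose chi (t : {set V}) := [exists x in t, P x].
have chi1 x : chi [set x] = P x.
  by apply/exists_inP/idP => [[y /set1P ->]//|h]; exists x; rewrite ?inE.
(* The columns are the indicators of P and of its complement; the rows of a and b show their
   independence. *)
pose W : 'M[F]_(#|faces K 1|, 2) := (\matrix_(i, j) (chi (enum_val i) == (j == 0))%:R)%R.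
have rW : (2 <= \rank W)%N.
  have fa : [set a] \in faces K 1 by rewrite inE ha cards1.
  have fb : [set b] \in faces K 1 by rewrite inE hb cards1.
  pose f (j : 'I_2) := if j == 0%R then enum_rank_in fa [set a] else enum_rank_in fa [set b].
  rewrite -[X in (X <= _)%N](mxrank1 F 2); apply: leq_trans (mxrank_mxsub f id W).
  rewrite eq_leq //; congr (\rank _); apply/matrixP => i j; rewrite !mxE /f.
  by case: (eqVneq i 0%R) => hi; rewrite enum_rankK_in // chi1 ?Pa ?(negPf Pb);
    case: i hi => -[|[|i]] hi //; case: j => -[|[|j]] hj.
have W0 : (bd_mx F K 2 *m W = 0)%R.
  apply/matrixP => i c; rewrite [RHS]mxE mxE.
  have := enum_valP i; rewrite inE => /andP [hs /cards2P [x [y [hxy es]]]].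
  pose G (t : {set V}) : F := ((if (t \subset [set x; y]) && (#|[set x; y] :\: t| == 1)%N
    then \sum_(v in [set x; y] :\: t) bd_sign F [set x; y] v else 0) * (chi t == (c == 0))%:R)%R.
  rewrite (eq_bigr (fun j => G (enum_val j))); last by move=> j _; rewrite !mxE es.
  rewrite -(big_enum_val G) /=.
  have fx : [set x] \in faces K 1 by rewrite inE cards1 andbT (hK _ _ hs) // es sub1set set21.
  have fy : [set y] \in faces K 1 by rewrite inE cards1 andbT (hK _ _ hs) // es sub1set set22.
  have Dx : [set x; y] :\: [set x] = [set y] by rewrite setU1K // inE.
  have Dy : [set x; y] :\: [set y] = [set x] by rewrite setUC setU1K // inE eq_sym.
  have nxy : [set y] != [set x] by apply: contra hxy => /eqP/set1_inj ->.
  rewrite (bigD1 [set x]) //= (bigD1 [set y]) /=; last by rewrite fy.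
  rewrite big1 ?addr0; last first.
    move=> t /andP [/andP [ft tx] ty]; rewrite /G; case: ifP => [/andP [hts _]|_];
      last by rewrite mul0r.
    move: ft; rewrite inE => /andP [_ /cards1P [z ez]].
    by move: hts tx ty; rewrite ez sub1set !inE => /orP [] /eqP ->; rewrite eqxx.
  rewrite /G Dx Dy !cards1 !sub1set set21 set22 /= !big_set1 !chi1.
  by rewrite (hP x y) // -?es // -mulrDl es addrC bd_sign_pair // mul0r.
(* Two independent cocycles against an augmentation of rank at most one leave a nonzero class. *)
have h1 : (\rank (bd_mx F K 2) + \rank W <= #|faces K 1|)%N := mulmx0_rank_max W0.
have := rank_bd1 K; rewrite /rbetti;
  move: (\rank (bd_mx F K 1)) (\rank (bd_mx F K 2)) h1 rW => r1 r2; lia.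
Qed.

Variables (D : {set {set V}}) (d : nat).
Hypothesis Dc : is_complex D.
Hypothesis Ds : homology_sphere F D d.

Let Dsub s t : s \in D -> t \subset s -> t \in D. Proof. exact: (proj1 Dc). Qed.

Lemma in_link s t : (t \in link D s) = [disjoint s & t] && (s :|: t \in D).
Proof.
apply/imsetP/andP => [[q]|[hd hD]].
  rewrite inE => /andP [hq hsq] ->; split.
    by rewrite -setI_eq0; apply/eqP/setP => x; rewrite !inE; case: (x \in s).
  suff -> : s :|: (q :\: s) = q by [].
  by apply/setP => x; rewrite !inE; case: (boolP (x \in s)) => //= /(subsetP hsq) ->.
exists (s :|: t); first by rewrite inE hD subsetUl.
by rewrite setDUl setDv set0U (setDidPl _) // disjoint_sym.
Qed.

Lemma link_sub s t t' : t \in link D s -> t' \subset t -> t' \in link D s.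
Proof.
rewrite !in_link => /andP [hd hD] ht; rewrite (disjointWr ht hd) /=.
by apply: (Dsub hD); apply: setUS.
Qed.

Lemma facet_card s : s \in faces D d -> #|s| = d.
Proof. by rewrite inE => /andP [_ /eqP]. Qed.

Lemma facet_in s : s \in faces D d -> s \in D.
Proof. by rewrite inE => /andP []. Qed.

Lemma facet_ex s : s \in D -> exists2 t : {set V}, t \in faces D d & s \subset t.
Proof.
have [[_ h] _] := Ds; move=> /h [t ht /andP [hst ct]].
by exists t => //; rewrite inE ht.
Qed.

(** By purity the link of a ridge is a set of isolated points, and the augmentation has rank one;
    the number of points minus one is the Betti number 1. *)
Lemma ridge_deg s : s \in D -> #|s|.+1 = d -> deg (faces D d) s = 2.
Proof.
move=> hs cs; have [[hpure _] /(_ s hs 1%N)] := Ds.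
have -> : (1 == d - #|s|)%N by rewrite -cs subSnn.
rewrite /rbetti; have n1 : #|faces (link D s) 1| = deg (faces D d) s.
  rewrite /deg -(card_in_imset (f := fun t => t :\: s) (D := mem [set t in faces D d | s \subset
    t])); last first.
    move=> t t'; rewrite !inE => /andP [_ ht] /andP [_ ht'] h.
    by rewrite -(setID t s) -(setID t' s) h (setIidPr ht) (setIidPr ht').
  apply: eq_card => t; apply/idP/imsetP => [|[q]].
    rewrite inE in_link => /andP [/andP [hd hD] /eqP ct]; exists (s :|: t).
      rewrite !inE hD subsetUl andbT /=.
      by move: hd; rewrite -leq_card_setU => /eqP ->; rewrite ct addn1 cs.
    by rewrite setDUl setDv set0U (setDidPl _) // disjoint_sym.
  rewrite !inE => /andP [/andP [hD /eqP cq] hsq] ->; rewrite cardsDS // cq -cs subSnn eqxx andbT.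
  rewrite in_link -setI_eq0; apply/andP; split.
    by apply/eqP/setP => x; rewrite !inE; case: (x \in s).
  suff -> : s :|: (q :\: s) = q by [].
  by apply/setP => x; rewrite !inE; case: (boolP (x \in s)) => //= /(subsetP hsq) ->.
have -> : \rank (bd_mx F (link D s) 2) = 0%N.
  apply/eqP; rewrite -leqn0; apply: leq_trans (rank_leq_row _) _; rewrite leqn0 cards_eq0.
  apply/eqP/setP => t; rewrite !inE in_link; apply/negP => /andP [/andP [hd hD] /eqP ct].
  have := hpure _ hD; move: hd; rewrite -leq_card_setU => /eqP ->; rewrite ct -cs; lia.
have r1 := rank_bd1 (link D s); move=> h.
suff r1' : (0 < \rank (bd_mx F (link D s) 1))%N.
  have e1 : \rank (bd_mx F (link D s) 1) = 1%N by lia.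
  by move: h; rewrite e1 n1; lia.
have /card_gt0P [t ht] : (0 < #|faces (link D s) 1|)%N by lia.
have /setIdP [tl /cards1P [x et]] := ht.
have h0 : set0 \in faces (link D s) 1.-1 by rewrite inE cards0 (link_sub tl) ?sub0set.
rewrite lt0n mxrank_eq0; apply/eqP => /matrixP /(_ (enum_rank_in ht t) (enum_rank_in h0 set0)).
rewrite !mxE /= !enum_rankK_in // sub0set setD0 et cards1 big_set1 => /eqP.
by rewrite signr_eq0.
Qed.

Lemma ridge_even t : #|t|.+1 = d -> odd (deg (faces D d) t) = false.
Proof.
move=> ct; have [ht|ht] := boolP (t \in D); first by rewrite ridge_deg.
by rewrite deg0 // => s hs; apply: contra ht; apply: Dsub; apply: facet_in.
Qed.

Definition lk_facets s : {set {set V}} :=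
  [set t :\: s | t in [set t in faces D d | s \subset t]].

Lemma lk_facetsP s q : reflect (exists t, [/\ t \in faces D d, s \subset t & q = t :\: s]) (q \in
  lk_facets s).
Proof.
apply: (iffP imsetP) => [[t /setIdP [h1 h2] ->]|[t [h1 h2 ->]]]; first by exists t.
by exists t => //; rewrite inE h1.
Qed.

Lemma lk_setDK s t : s \subset t -> s :|: (t :\: s) = t.
Proof.
by move=> /subsetP h; apply/setP => x; rewrite !inE; case: (boolP (x \in s)) => //= /h ->.
Qed.

Lemma lk_deg s Z t : Z \subset lk_facets s -> [disjoint s & t] ->
  deg Z t = #|[set q in faces D d | (s :|: t \subset q) && (q :\: s \in Z)]|.
Proof.
move=> /subsetP hZ hst; rewrite /deg.
rewrite -(card_in_imset (f := fun q => q :\: s)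
  (D := mem [set q in faces D d | (s :|: t \subset q) && (q :\: s \in Z)])); last first.
  move=> q q'; rewrite !inE !subUset => /and3P [_ /andP [h _] _] /and3P [_ /andP [h' _] _] e.
  by rewrite -(lk_setDK h) e lk_setDK.
apply: eq_card => x; apply/setIdP/imsetP => [[hx htx]|[q /setIdP [hq /andP [h1 h2]] ->]].
  have /lk_facetsP [q [hq hsq e]] := hZ _ hx; exists q => //.
  rewrite inE hq -e hx andbT subUset hsq /=; apply: subset_trans htx _.
  by rewrite e subsetDl.
split=> //; move: h1; rewrite subUset => /andP [_ ht].
by rewrite subsetD ht disjoint_sym.
Qed.

Lemma lk_cycle s r : s \in D -> (#|s| + r = d)%N -> is_cycle r (lk_facets s).
Proof.
move=> hs hr; apply/is_cycleP; split=> [q /lk_facetsP [t [ht hst ->]]|t ct].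
  by rewrite cardsDS // (facet_card ht) -hr addKn.
have [hd|hd] := boolP [disjoint s & t]; last first.
  rewrite deg0 // => q /lk_facetsP [p [_ _ ->]]; apply: contra hd => h.
  by move: h; rewrite subsetD disjoint_sym => /andP [].
rewrite (lk_deg (subxx _) hd) -(ridge_even (t := s :|: t)); last first.
  by move: hd; rewrite -leq_card_setU => /eqP ->; rewrite -hr -ct addnS.
congr (odd _); apply: eq_card => q; rewrite !inE.
case: (boolP (s :|: t \subset q)) => h; rewrite ?andbF //=; case: (boolP (q \in D)) => hq //=.
case: eqP => cq //=; apply/lk_facetsP; exists q; split => //; first by rewrite inE hq cq eqxx.
by move: h; rewrite subUset => /andP [].
Qed.

(** Evenness closes a subcycle under adjacency across ridges, so minimality amounts to strong
    connectedness. This is derived from connectedness of the links of faces with at most d - 2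
    vertices. *)
Lemma lk_minimal_cycle s r : s \in D -> (#|s| + r = d)%N -> (2 <= r)%N -> minimal_cycle r
  (lk_facets s).
Proof.
move=> hs hr r2; split; first exact: lk_cycle.
  have [t ht hst] := facet_ex hs; apply/set0Pn; exists (t :\: s).
  by apply/lk_facetsP; exists t.
move=> Z hZ /is_cycleP [_ cZ].
have [->|/set0Pn [q0 hq0]] := eqVneq Z set0; [by left|right; apply/eqP].
rewrite eqEsubset hZ; apply: contraT => /subsetPn [q1 hq1 nq1].
have /lk_facetsP [a0 [fa0 sa0 ea0]] := subsetP hZ _ hq0.
have /lk_facetsP [b0 [fb0 sb0 eb0]] := hq1.
pose A := [set a in faces D d | (s \subset a) && (a :\: s \in Z)].
pose B := [set a in faces D d | (s \subset a) && (a :\: s \notin Z)].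
have hab0 : (a0 \in A) && (b0 \in B) by apply/andP; split; apply/setIdP;
  rewrite ?fa0 ?fb0 ?sa0 ?sb0 -?ea0 -?eb0 ?hq0 ?nq1.
(* Adjacent facets are both in or both out of Z; among pairs of facets separated by Z,
   one with maximal intersection t would disconnect the link of t. *)
pose Q (p : {set V} * {set V}) := (p.1 \in A) && (p.2 \in B).
have [[a b] /andP [/= /setIdP [fa /andP [sa Za]] /setIdP [fb /andP [sb Zb]]] hmax] :=
  @arg_maxnP _ (a0, b0) Q (fun p => #|p.1 :&: p.2|) hab0.
have {}hmax p q w : p \in A -> q \in B -> w \notin a :&: b -> w |: (a :&: b) \subset p :&: q ->
  False.
  move=> hp hq hw hsub; have := hmax (p, q); rewrite /Q hp hq => /(_ isT) /=.
  apply/negP; rewrite -ltnNge; apply: leq_trans (subset_leq_card hsub).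
  by rewrite cardsU1 hw.
have nab : a != b by apply: contraNneq Zb => <-.
set t := a :&: b in hmax *.
have st : s \subset t by rewrite subsetI sa.
have tD : t \in D by apply: Dsub (facet_in fa) (subsetIl _ _).
have ct : (#|t| < d)%N.
  rewrite -(facet_card fa); apply: proper_card; rewrite properEneq subsetIl andbT.
  apply: contra nab => /eqP e; rewrite eqEcard (facet_card fa) (facet_card fb) leqnn andbT.
  by rewrite -e subsetIr.
(* If t is a ridge, a and b are its only facets and just one comes from Z, against evenness. *)
have [hd|hd] := eqVneq #|t|.+1 d.
  have hdeg := ridge_deg tD hd.
  have hodd : odd (deg Z (t :\: s)) = false.
    by apply: cZ; apply/eqP;
      rewrite cardsDS // -(eqn_add2l #|s|) hr addnS subnKC ?subset_leq_card // hd.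
  have dst : [disjoint s & t :\: s].
    by rewrite -setI_eq0; apply/eqP/setP => x; rewrite !inE; case: (x \in s).
  move: hodd; rewrite (lk_deg hZ dst).
  rewrite lk_setDK //.
  suff -> : [set q in faces D d | (t \subset q) && (q :\: s \in Z)] = [set a] by rewrite cards1.
  have e2 : [set q in faces D d | t \subset q] = [set a; b].
    apply/esym/eqP; rewrite eqEcard cards2 nab -[#|[set q in _ | _]|]/(deg _ _) hdeg leqnn andbT.
    by rewrite subUset !sub1set; apply/andP; split; apply/setIdP;
      rewrite ?fa ?fb ?subsetIl ?subsetIr.
  apply/setP => q; have := congr1 (fun S : {set {set V}} => q \in S) e2.
  rewrite /= [in X in X -> _]inE => e3; rewrite inE andbA e3 !inE andb_orl.
  case: (eqVneq q a) => [->|_] /=; first by rewrite Za.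
  by case: (eqVneq q b) => [->|//]; rewrite (negPf Zb).
have [_ /(_ t tD 1%N)] := Ds.
have -> : (1 == d - #|t|)%N = false by rewrite ltn_eqF // ltn_subRL addn1 ltn_neqAle hd.
move=> hb; exfalso; move: hb.
have [x hx] : exists x, x \in a :\: b.
  by apply/set0Pn; rewrite setD_eq0; apply: contra nab => h;
    rewrite eqEcard h (facet_card fa) (facet_card fb) leqnn.
have [y hy] : exists y, y \in b :\: a.
  by apply/set0Pn; rewrite setD_eq0; apply: contra nab => h;
    rewrite eq_sym eqEcard h (facet_card fa) (facet_card fb) leqnn.
move: hx hy; rewrite !in_setD => /andP [xb xa] /andP [ya yb].
have xt : x \notin t by rewrite in_setI (negPf xb) andbF.
have yt : y \notin t by rewrite in_setI (negPf ya).
have aA : a \in A by rewrite inE fa sa Za.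
have bB : b \in B by rewrite inE fb sb Zb.
(* Every facet over t is in A or in B. A vertex of the link lying in facets of both kinds would
   enlarge the maximal intersection, so P separates x from y. *)
pose P z := [exists q in A, z |: t \subset q].
have PB z q : z \notin t -> q \in B -> z |: t \subset q -> ~~ P z.
  move=> hz hq hzq; apply/negP => /exists_inP [p hp hzp].
  by apply: (hmax p q z) => //; rewrite subsetI hzp.
apply: (rbetti_disconnected (P := P) (a := x) (b := y)).
- by move=> p q; apply: link_sub.
- move=> z w zw; rewrite in_link => /andP [hdis hD].
  have [q fq] := facet_ex hD; rewrite !subUset !sub1set => /and3P [tq zq wq].
  have zt : z \notin t by apply/negP => h; move/pred0P/(_ z): hdis; rewrite /= h set21.
  have wt : w \notin t by apply/negP => h; move/pred0P/(_ w): hdis; rewrite /= h set22.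
  have [Zq|Zq] := boolP (q :\: s \in Z).
    have qA : q \in A by rewrite inE fq Zq (subset_trans st tq).
    have -> : P z by apply/exists_inP; exists q; rewrite // subUset sub1set zq.
    by apply/esym/exists_inP; exists q; rewrite // subUset sub1set wq.
  have qB : q \in B by rewrite inE fq Zq (subset_trans st tq).
  rewrite (negPf (PB z q zt qB _)) ?(negPf (PB w q wt qB _)) // subUset sub1set ?zq ?wq //.
- rewrite in_link disjoint_sym disjoints1 xt; apply: (Dsub (facet_in fa)).
  by rewrite subUset subsetIl sub1set.
- rewrite in_link disjoint_sym disjoints1 yt; apply: (Dsub (facet_in fb)).
  by rewrite subUset subsetIr sub1set.
- by apply/exists_inP; exists a; rewrite // subUset sub1set xa subsetIl.
- by apply: (PB y b) => //; rewrite subUset sub1set yb subsetIr.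
Qed.

End Topology.

(** * Redundant edges of prime homology spheres *)

Section Simplex.
Variable V : finType.
Implicit Types (s t S : {set V}).

Definition simplex_bd d S : {set {set V}} := [set s : {set V} | (s \subset S) && (#|s| == d)].

Lemma codim1_setD1 S s : s \subset S -> #|S| = #|s|.+1 -> exists2 x, x \in S & s = S :\ x.
Proof.
move=> hs cS; have /cards1P [x hx] : #|S :\: s| == 1 by rewrite cardsDS // cS subSnn.
have : x \in S :\: s by rewrite hx set11.
rewrite inE => /andP [xs xS]; exists x => //; apply/eqP; rewrite eqEcard.
have -> : #|S :\ x| = #|s| by move: cS; rewrite (cardsD1 x) xS add1n => -[].
by rewrite leqnn andbT subsetD1 hs.
Qed.

Lemma simplex_bd_cycle d S : #|S| = d.+1 -> is_cycle d (simplex_bd d S).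
Proof.
move=> cS; apply/is_cycleP; split=> [s|t ct]; first by rewrite inE => /andP [_ /eqP].
have [tS|tS] := boolP (t \subset S); last first.
  rewrite deg0 // => s; rewrite inE => /andP [hs _]; apply: contra tS => h;
    exact: subset_trans h hs.
have -> : deg (simplex_bd d S) t = #|S :\: t|.
  rewrite /deg -(card_in_imset (f := fun x => x |: t) (D := mem (S :\: t))); last first.
    move=> x y; rewrite !in_setD => /andP [hx _] /andP [hy _] h.
    have : x \in y |: t by rewrite -h setU11.
    by rewrite !inE (negPf hx) orbF => /eqP.
  apply: eq_card => s; apply/setIdP/imsetP => [[]|[x]].
    rewrite inE => /andP [hs /eqP cs] hts.
    have [|x xs e] := codim1_setD1 hts; first by rewrite cs ct.
    exists x; last by rewrite e setD1K.
    by rewrite inE (subsetP hs) // e !inE eqxx.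
  rewrite inE => /andP [xt xS] ->; rewrite inE subUset sub1set xS tS cardsU1 xt add1n ct eqxx.
  by rewrite subsetUr.
by rewrite cardsDS // cS -ct subSn // subSnn.
Qed.

End Simplex.

Section Final.
Variables (F : fieldType) (V : finType) (D : {set {set V}}) (d : nat).
Hypothesis hd : 4 <= d.
Hypothesis Dc : is_complex D.
Hypothesis Ds : homology_sphere F D d.
Hypothesis Dprime : prime_cx D d.
Hypothesis Dg2 : (0 < g2 D d)%R.
Implicit Types (s t S : {set V}).

Let Dsub s t : s \in D -> t \subset s -> t \in D. Proof. exact: (proj1 Dc). Qed.
Let Dvert v : [set v] \in D. Proof. exact: (proj2 Dc). Qed.

Lemma complex_set0 s : s \in D -> set0 \in D.
Proof. by move=> hs; apply: Dsub hs _; apply: sub0set. Qed.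

Lemma lk_facets0 : lk_facets D d set0 = faces D d.
Proof.
apply/setP => s; apply/lk_facetsP/idP => [[t [ht _ ->]]|hs]; first by rewrite setD0.
by exists s; rewrite setD0 sub0set.
Qed.

Lemma facets_minimal_cycle s : s \in D -> minimal_cycle d (faces D d).
Proof.
move=> /complex_set0 h0; rewrite -lk_facets0; apply: (lk_minimal_cycle Dc Ds h0);
  first by rewrite cards0.
exact: leq_trans hd.
Qed.

Lemma vert_facets : vert (faces D d) = [set: V].
Proof.
apply/setP => v; rewrite inE; have [s hs vs] := facet_ex Ds (Dvert v).
by apply/vertP; exists s => //; rewrite -sub1set.
Qed.

Lemma join_graph_facets : join_graph set0 (faces D d) = graph_edges D.
Proof.
apply/setP => e; apply/join_graphP/setIdP => [[ce [s hs]]|[he /eqP ce]].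
  by rewrite set0U => hes; rewrite ce (Dsub (facet_in hs) hes).
by split=> //; have [s hs hes] := facet_ex Ds he; exists s; rewrite // set0U.
Qed.

(** By minimality D would have no other facets than this simplex boundary, and then g2 = 2 C(d + 1,
    2) - d(d + 1) = 0. *)
Lemma no_simplex S : #|S| = d.+1 -> (forall s, s \subset S -> #|s| = d -> s \in D) -> False.
Proof.
move=> cS hS; have hB : simplex_bd d S \subset faces D d.
  by apply/subsetP => s; rewrite !inE => /andP [hs /eqP cs]; rewrite hS ?cs ?eqxx.
have [x xS] : exists x, x \in S by apply/card_gt0P; rewrite cS.
have csx y : y \in S -> #|S :\ y| = d by move=> yS; move: cS; rewrite (cardsD1 y) yS add1n => -[].
have hx y : y \in S -> S :\ y \in simplex_bd d S by move=> yS; rewrite inE subsetDl csx ?eqxx.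
have [_ _ hmin] := facets_minimal_cycle (facet_in (subsetP hB _ (hx x xS))).
have eB : simplex_bd d S = faces D d.
  by case: (hmin _ hB (simplex_bd_cycle cS)) => // h; move: (hx x xS); rewrite h inE.
have ST : S = [set: V].
  apply/eqP; rewrite eqEsubset subsetT -vert_facets -eB; apply/subsetP => y /vertP [s].
  by rewrite inE => /andP [/subsetP h _] /h.
have f1 : #|faces D 1| = d.+1.
  rewrite -cS ST -[RHS]bin1 -(cards_draws [set: V] 1).
  apply: eq_card => s; rewrite !inE subsetT /= andbC;
    case: (boolP (#|s| == 1)) => //= /cards1P [y ->].
  exact: Dvert.
have f2 : #|faces D 2| = 'C(d.+1, 2).
  rewrite -cS ST -(cards_draws [set: V] 2).
  apply: eq_card => s; rewrite !inE subsetT /= andbC; case: (boolP (#|s| == 2)) => //= /eqP cs.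
  have [y yS] : exists y, y \in S :\: s.
    apply/card_gt0P; rewrite cardsDS ?ST ?subsetT // -ST cS cs subn_gt0.
    by rewrite ltnS (leq_trans _ hd).
  move: yS; rewrite inE => /andP [ys yS].
  by apply: Dsub (hS _ _ (csx y yS)) _; [apply: subsetDl|rewrite subsetD1 ST subsetT].
move: Dg2; rewrite /g2 f1 f2.
have h n : 'C(n.+1, 2) + 'C(n.+1, 2) = n * n.+1.
  by elim: n => // n IH; rewrite (binS n.+1) bin1; clear -IH; lia.
have := h d; clear; lia.
Qed.

Variables (R : realFieldType) (phi : V -> 'rV[R]_d).
Hypothesis phi_gen : generic_embedding phi.
Variables (u v : V).
Hypothesis huv : u != v.
Hypothesis he : [set u; v] \in D.
Local Notation G := (graph_edges D).
Local Notation e := [set u; v].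
Local Notation C := (faces D d).

Lemma rigid_graph_edges : rigid phi G [set: V].
Proof.
have := fogelsanger phi_gen (r := d) (T := set0) (C := C) _ _ _ (facets_minimal_cycle he).
rewrite cards0 add0n join_graph_facets vert_facets set0U; apply => //; first exact: leq_trans hd.
by rewrite -setI_eq0 set0I.
Qed.

(** If u and v lie in a set that is rigid without e, the bar e is implied, and G - e has the same
    motions as the rigid graph G. *)
Lemma redundant_closure (U : {set V}) : u \in U -> v \in U -> rigid phi (G :\ e) U -> rigid phi
  (G :\ e) [set: V].
Proof.
move=> uU vU h; apply: (rigid_trans rigid_graph_edges) => mu hmu a b hab hG.
have [heq|hne] := eqVneq [set a; b] e; last by apply: hmu; rewrite // in_setD1 hne.
have inU x : x \in e -> x \in U by rewrite !inE => /orP [] /eqP ->.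
by apply: h => //; apply: inU; rewrite -heq ?set21 ?set22.
Qed.

Lemma join_graph_sub T (K : {set {set V}}) : (forall s, s \in K -> T :|: s \in D /\ ~~ (e \subset
  T :|: s)) ->
  join_graph T K \subset G :\ e.
Proof.
move=> hK; apply/subsetP => q /join_graphP [cq [s /hK [hs hns] hqs]]; rewrite in_setD1.
rewrite /graph_edges inE cq eqxx andbT (Dsub hs hqs) andbT.
by apply: contra hns => /eqP <-.
Qed.

Lemma redundant_missing S : S \notin D -> (forall s, s \proper S -> s \in D) ->
  e \subset S -> 2 < #|S| -> rigid phi (G :\ e) [set: V].
Proof.
move=> nS pS eS cS.
have /andP [uS vS] : (u \in S) && (v \in S) by move: eS; rewrite subUset !sub1set.
have nd : #|S| <> d by move=> h; apply: (Dprime h); split.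
have nd1 : #|S| <> d.+1.
  by move=> h; apply: (no_simplex h) => s hs cs; apply: pS; rewrite properEcard hs cs h ltnSn.
have hle : #|S| <= d.+1.
  have h : S :\ u \in D by apply: pS; rewrite properD1.
  by have [[hp _] _] := Ds; have := hp _ h; rewrite (cardsD1 u S) uS add1n ltnS.
have hlt : #|S| < d by move: nd nd1 hle; clear; lia.
pose T := S :\: e.
have cT : #|T| + 2 = #|S| by rewrite cardsDS // cards2 huv subnK // ltnW.
have TD : T \in D.
  by apply: pS; rewrite properEcard subsetDl /= -cT -[X in X < _]addn0 ltn_add2l.
(* From |S| < d follows |T| <= d - 3, which gives the r >= 3 that [fogelsanger] asks for. *)
pose r := d - #|T|.
have r3 : 3 <= r by rewrite /r; move: cT hlt; clear; lia.
have hr : #|T| + r = d by rewrite /r; move: cT hlt; clear; lia.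
have hM := lk_minimal_cycle Dc Ds TD hr (ltnW r3).
have dTM : [disjoint T & vert (lk_facets D d T)].
  rewrite -setI_eq0; apply/eqP/setP => x; rewrite in_set0 in_setI; apply/negP => /andP [xT].
  by move=> /vertP [q /lk_facetsP [t [_ _ ->]]]; rewrite inE xT.
(* [x |: T] omits the other end of e, so it is a proper subset of S and hence a face; both ends are
   thus vertices of the link of T. *)
have inM x y : x != y -> e = [set x; y] -> x \in vert (lk_facets D d T).
  move=> xy ee; have xyS : (x \in S) && (y \in S) by move: eS; rewrite ee subUset !sub1set.
  have /andP [xS yS] := xyS.
  have xT : x |: T \in D.
    apply: pS; apply/properP; split; first by rewrite subUset sub1set xS subsetDl.
    by exists y => //; rewrite /T ee !inE eqxx (eq_sym y) (negPf xy) orbT.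
  have [q hq] := facet_ex Ds xT; rewrite subUset sub1set => /andP [xq Tq].
  apply/vertP; exists (q :\: T); first by apply/lk_facetsP; exists q.
  by rewrite /T ee !inE eqxx xq.
apply: (@redundant_closure (T :|: vert (lk_facets D d T))).
- by rewrite inE (inM u v) ?orbT.
- by rewrite inE (inM v u) ?orbT // 1?eq_sym // setUC.
apply: (rigid_mono _ (subxx _) (fogelsanger phi_gen r3 hr dTM hM)).
apply: join_graph_sub => s /lk_facetsP [q [hq hTq ->]]; rewrite lk_setDK //; split;
  first exact: facet_in hq.
apply: contra nS => heq; apply: Dsub (facet_in hq) _.
by apply/subsetP => x xS; have [xe|xe] := boolP (x \in e);
  [apply: (subsetP heq)|apply: (subsetP hTq); rewrite inE xe].
Qed.

(** * Edges uv for which the links of u and v meet exactly in the link of uv *)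

Hypothesis link_cond : forall t, u |: t \in D -> v |: t \in D -> u |: (v |: t) \in D.

Local Notation X0 := (off_edge u v C).
Local Notation H := (hinge d u v X0).

Let Ccyc : is_cycle d C. Proof. by case: (facets_minimal_cycle he). Qed.

Let inH s : (s \in H) = (s \in C) && (e \subset s).
Proof. by rewrite hinge_off_edge // subUset !sub1set. Qed.

(** A hinge simplex s has [s :\ u] and [s :\ v] in D, so the link condition puts s in D. A half
    cycle inside X0 therefore fills to a subcycle of C, and minimality of C applies. *)
Lemma off_edge_irreducible : irreducible d u v X0.
Proof.
have gX := off_edge_half_cycle huv Ccyc; split=> // L hL gL.
have hLC := subset_trans hL (off_edgeS u v C).
have hsub : fill d u v L \subset C.
  rewrite subUset hLC; apply/subsetP => s hs; have := hs; rewrite inE => /and4P [/eqP cs su sv _].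
  rewrite inE cs eqxx andbT.
  have es : u |: (v |: s :\: e) = s.
    by apply/setP => x; rewrite !inE; case: (eqVneq x u) => [->//|_];
      case: (eqVneq x v) => [->//|_].
  rewrite -es; apply: link_cond.
    have [|s' hs' hss'] := hinge_sub (x := v) gL hs; first by rewrite eqxx orbT.
    apply: Dsub (facet_in (subsetP hLC _ hs')) _; apply: subset_trans hss'.
    by apply/subsetP => x; rewrite !inE; case: (eqVneq x u) => [->|_];
      rewrite ?huv ?su //= => /andP [/negPf ->].
  have [|s' hs' hss'] := hinge_sub (x := u) gL hs; first by rewrite eqxx.
  apply: Dsub (facet_in (subsetP hLC _ hs')) _; apply: subset_trans hss'.
  by apply/subsetP => x; rewrite !inE; case: (eqVneq x v) => [->|_];
    rewrite 1?eq_sym ?huv ?sv //= orbF => /andP [/negPf ->].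
have [_ _ hmin] := facets_minimal_cycle he.
case: (hmin _ hsub (fill_cycle huv gL)) => h; [left|right].
  by apply/eqP; rewrite -subset0 -h subsetUl.
apply/eqP; rewrite eqEsubset hL; apply/subsetP => s hs.
have : s \in fill d u v L by rewrite h; apply: (subsetP (off_edgeS u v C)).
rewrite /fill in_setU => /orP [//|]; rewrite inE => /and4P [_ a b _].
by move: hs; rewrite inE a b andbF.
Qed.

(** H consists of the facets through uv, so N is the vertex set of the link of uv. *)
Local Notation N := (vert H :\: e).

Let HD s : s \in H -> [/\ s \in D, #|s| = d, u \in s & v \in s].
Proof.
by rewrite inH subUset !sub1set => /and3P [hs su sv]; rewrite (facet_in hs) (facet_card hs).
Qed.

Lemma join_graph_off_edge : join_graph set0 X0 \subset G :\ e.
Proof.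
apply: join_graph_sub => s; rewrite set0U inE => /andP [hs nuv].
by rewrite (facet_in hs) subUset !sub1set.
Qed.

Lemma hinge_facet : exists s, s \in H.
Proof. by have [s hs hes] := facet_ex Ds he; exists s; rewrite inH hs. Qed.

(** Every vertex of N is joined to u and to v inside X0, so d of them pay for the split without the
    bar uv. *)
Lemma redundant_contract : d <= #|N| -> rigid phi (G :\ e) [set: V].
Proof.
move=> /subset_of_card [S hS cS].
have hirr := off_edge_irreducible; have [gX _] := hirr.
have [s hs] := hinge_facet; have [_ cs su sv] := HD hs.
have X00 : X0 != set0.
  have [|s' hs' _] := hinge_sub (x := u) gX hs; first by rewrite eqxx.
  by apply/set0Pn; exists s'.
have SN a : a \in S -> exists s', [/\ s' \in H, a \in s', a != u & a != v].
  move=> /(subsetP hS); rewrite !inE negb_or => /andP [/andP [au av]] /vertP [s' hs' as'].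
  by exists s'.
(* A pair [u |: q], [v |: q] and the link condition would put the whole boundary of the simplex on
   u, v and q into D. *)
have hp : ~~ has_pair u v X0.
  apply/negP => /(irreducible_pair huv hirr) [q [uq vq eX]].
  have qX : u |: q \in C by apply: (subsetP (off_edgeS u v C)); rewrite eX set21.
  have qX' : v |: q \in C by apply: (subsetP (off_edgeS u v C)); rewrite eX set22.
  have cq : #|u |: (v |: q)| = d.+1.
    by rewrite cardsU1 !inE negb_or huv uq add1n (facet_card qX').
  apply: (no_simplex cq) => t ht ct.
  have [|x] := codim1_setD1 ht; first by rewrite cq ct.
  have e1 : (u |: (v |: q)) :\ u = v |: q by rewrite setU1K // !inE negb_or huv.
  have e2 : (u |: (v |: q)) :\ v = u |: q.
    by rewrite setUCA setU1K // !inE negb_or eq_sym huv.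
  rewrite !inE => /or3P [/eqP -> ->|/eqP -> ->|xq ->].
  - by rewrite e1 (facet_in qX').
  - by rewrite e2 (facet_in qX).
  have xu : x != u by apply: contraNneq uq => <-.
  have xv : x != v by apply: contraNneq vq => <-.
  have -> : (u |: (v |: q)) :\ x = u |: (v |: q :\ x).
    by apply/setP => y; rewrite !inE; case: (eqVneq y x) => [->|] //=;
      rewrite (negPf xu) (negPf xv).
  by apply: link_cond; [apply: Dsub (facet_in qX) _|apply: Dsub (facet_in qX') _]; apply: setUS;
    apply: subsetDl.
have hmc := contract_minimal_cycle huv hirr X00 hp.
have d0 (K : {set {set V}}) : [disjoint (set0 : {set V}) & vert K] by rewrite -setI_eq0 set0I.
have h0 : #|(set0 : {set V})| + d = d by rewrite cards0.
have h3 : 3 <= d by apply: leq_trans hd.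
have hrig := fogelsanger phi_gen h3 h0 (d0 _) hmc.
have := split_step phi_gen huv h0 (d0 _) gX hs hrig (sub0set _) (S := S) _ cS _ _.
rewrite setU0 set0U => hspl.
apply: (@redundant_closure (u |: (v |: vert X0))); rewrite ?setU11 ?inE ?eqxx ?orbT //.
apply: (rigid_mono join_graph_off_edge (subxx _)); apply: hspl.
- by apply/negP => /SN [s' [_ _ _]]; rewrite eqxx.
- move=> a aS _; have [s' [hs' as' au av]] := SN a aS.
  by apply: (hinge_nbr huv gX hs'); rewrite // set0U.
- by move=> /SN [s' [_ _]]; rewrite eqxx.
Qed.

Lemma redundant_flip : #|N| < d -> rigid phi (G :\ e) [set: V].
Proof.
move=> hN.
have gX := off_edge_half_cycle huv Ccyc.
have h3 : 3 <= d by apply: leq_trans hd.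
have ce : #|e| = 2 by rewrite cards2 huv.
have [s0 hs0] := hinge_facet; have [s0D cs0 us0 vs0] := HD hs0.
have HN s : s \in H -> s \subset e :|: N.
  by move=> hs; apply/subsetP => x xs;
    rewrite in_setU in_setD (subsetP (vert_sup hs)) // andbT orbN.
have eS s : s \in H -> e \subset s by move=> /HD [_ _ su sv]; rewrite subUset !sub1set su.
have [y [ys0 [s1 hs1 ys1]]] := hinge_common huv gX h3 hs0.
have yN : y \in N.
  rewrite in_setD (subsetP (vert_sup hs1)) // andbT.
  by apply: contra ys0; apply: (subsetP (eS _ hs0)).
have edN : [disjoint e & N] by rewrite -setI_eq0; apply/eqP/setP => x;
  rewrite in_setI in_setD in_set0; case: (x \in e).
have uN : u \notin N by rewrite !inE eqxx.
have vN : v \notin N by rewrite !inE eqxx orbT.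
have cS : #|e :|: N| = #|N| + 2 by move: edN; rewrite -leq_card_setU => /eqP ->; rewrite ce addnC.
have s0y : y |: s0 \subset e :|: N by rewrite subUset sub1set inE yN orbT HN.
(* s0 and y provide d + 1 vertices within e and N, so N has at least d - 1. *)
have cN : (#|N|).+1 = d.
  apply/eqP; rewrite eqn_leq hN /=; have := subset_leq_card s0y.
  by rewrite cardsU1 ys0 cs0 cS add1n addn2 ltnS.
have cS1 : #|e :|: N| = d.+1 by rewrite cS addn2 cN.
have es0 : e :|: N = y |: s0.
  by apply/esym/eqP; rewrite eqEcard s0y cS1 cardsU1 ys0 add1n cs0 leqnn.
(* Evenness of the hinge at [s0 :\ x] yields a second facet through uv; within d + 1 vertices it can
   only be the one omitting x. So the link of uv is the boundary of the simplex on N. *)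
have allH x : x \in N -> (e :|: N) :\ x \in H.
  move=> xN; have [->|xy] := eqVneq x y; first by rewrite es0 setU1K.
  have xe : x \notin e by move: xN; rewrite in_setD => /andP [].
  have xs0 : x \in s0.
    by have := subsetP (subsetUr e N) x xN; rewrite es0 in_setU1 (negPf xy).
  have ct : #|s0 :\ x|.+1 = d by rewrite -cs0 (cardsD1 x s0) xs0.
  have ut : u \in s0 :\ x by rewrite in_setD1 us0 andbT; apply: contraNneq xe => <-; rewrite set21.
  have vt : v \in s0 :\ x by rewrite in_setD1 vs0 andbT; apply: contraNneq xe => <-; rewrite set22.
  have [s2 [hs2 hss2 ne]] := even_deg_other (hinge_deg_even huv gX ct ut vt) hs0 (subsetDl _ _).
  have [_ cs2 _ _] := HD hs2.
  have [|z zS ez] := codim1_setD1 (HN _ hs2); first by rewrite cS1 cs2.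
  have zx : z = x.
    apply/eqP; apply: contraT => zx; have zs2 : z \notin s2 by rewrite ez !inE eqxx.
    have : z \notin s0 :\ x by apply: contra zs2; apply: (subsetP hss2).
    rewrite in_setD1 zx /= => zs0; case/eqP: ne; rewrite ez es0.
    by move: zS; rewrite es0 in_setU1 (negPf zs0) orbF => /eqP ->; rewrite setU1K.
  by rewrite -zx -ez.
have subH x t : x \in N -> t \subset (e :|: N) :\ x -> t \in D.
  by move=> xN ht; have [h _ _ _] := HD (allH x xN); apply: Dsub h ht.
have SDu : (e :|: N) :\ u = v |: N.
  by rewrite -setUA setU1K // in_setU1 negb_or huv.
have SDv : (e :|: N) :\ v = u |: N.
  move: (N) vN => A vA.
  by rewrite (setUC [set u]) -setUA setU1K // in_setU1 negb_or eq_sym huv.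
(* Once N is a face, all proper subsets of the d-set [w |: N] are faces, and primeness makes it a
   face; the complete simplex boundary would follow. *)
have prim w : w \in e -> N \in D -> w |: N \in D.
  move=> we ND; apply/negPn/negP => nD.
  have wN : w \notin N by rewrite in_setD we.
  apply: (Dprime (t := w |: N)); first by rewrite cardsU1 wN add1n cN.
  split=> // t /properP [ht [x xw xt]].
  have [ew|xNe] := eqVneq x w.
    apply: (Dsub ND); apply/subsetP => z zt; have := subsetP ht z zt.
    by rewrite in_setU1 => /orP [/eqP ez|//]; rewrite ez -ew (negPf xt) in zt.
  have xN : x \in N by move: xw; rewrite in_setU1 (negPf xNe).
  apply: (subH x) => //; rewrite subsetD1 xt andbT; apply: (subset_trans ht).
  by rewrite setSU // sub1set.
have ND : N \notin D.
  apply/negP => ND; apply: (no_simplex cS1) => t ht ct.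
  have [|x xS ->] := codim1_setD1 ht; first by rewrite cS1 ct.
  move: xS; rewrite in_setU => /orP [|xN]; last exact: (subH x).
  by rewrite in_set2 => /orP [] /eqP ->; rewrite ?SDu ?SDv prim ?set21 ?set22.
have B := simplex_bd_cycle cS1.
have HB : H \subset simplex_bd d (e :|: N).
  by apply/subsetP => s hs; rewrite inE HN //; have [_ -> _ _] := HD hs; rewrite eqxx.
have HC : H \subset C by apply/subsetP => s; rewrite inH => /andP [].
pose P := simplex_bd d (e :|: N) :\: H.
have PP s : s \in P -> s = u |: N \/ s = v |: N.
  rewrite in_setD => /andP [sH /setIdP [hs /eqP cs]].
  have [|x xS es] := codim1_setD1 hs; first by rewrite cS1 cs.
  move: xS; rewrite in_setU => /orP [|xN]; last by rewrite es allH in sH.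
  by rewrite in_set2 es => /orP [] /eqP ->; rewrite ?SDu ?SDv; [right|left].
have PN s : s \in P -> N \subset s by move=> /PP [] ->; apply: subsetUr.
have cwN w : w \in e -> #|w |: N| = d.
  by move=> we; rewrite cardsU1 in_setD we add1n cN.
have inP w : w \in e -> w |: N \in P.
  move=> we; rewrite in_setD; apply/andP; split; last first.
    by rewrite inE cwN // eqxx andbT setSU // sub1set.
  by apply: contra ND => /HD [h _ _ _]; apply: Dsub h (subsetUr _ _).
(* Modulo 2 this is C plus the boundary of the simplex on e and N: H cancels and P is added. *)
pose C' := (C :\: H) :|: P.
have CPd : [disjoint C :\: H & P].
  apply/pred0P => s /=; apply/negP => /andP [/setDP [hs _] /PN hNs].
  by case/negP: ND; apply: Dsub (facet_in hs) hNs.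
have /is_cycleP [cB1 cB2] := B; have /is_cycleP [cC1 cC2] := Ccyc.
have C'cyc : is_cycle d C'.
  apply/is_cycleP; split=> [s|t ct].
    by rewrite in_setU => /orP [/setDP [/cC1]|/setDP [/cB1]].
  by rewrite degU // oddD !degD // cC2 // cB2 // addbb.
(* As N is not a face, only [u |: N] and [v |: N] lie over it in C'. A subcycle omitting one omits
   both, and is then a proper subcycle of C. *)
have Zempty (Z : {set {set V}}) : Z \subset C' -> is_cycle d Z -> u |: N \notin Z -> Z = set0.
  move=> hZ hZc uZ; have /is_cycleP [_ cZ2] := hZc.
  have vZ : v |: N \notin Z.
    apply/negP => vZ; have [s [sZ Ns ne]] := even_deg_other (cZ2 N cN) vZ (subsetUr _ _).
    have := subsetP hZ _ sZ; rewrite in_setU => /orP [/setDP [sC _]|/PP [es|es]].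
    - by case/negP: ND; apply: Dsub (facet_in sC) Ns.
    - by rewrite -es sZ in uZ.
    - by rewrite es eqxx in ne.
  have hZC : Z \subset C :\: H.
    apply/subsetP => s sZ; have := subsetP hZ _ sZ; rewrite in_setU => /orP [//|/PP [es|es]].
      by rewrite -es sZ in uZ.
    by rewrite -es sZ in vZ.
  have [_ _ hmin] := facets_minimal_cycle he.
  case: (hmin Z (subset_trans hZC (subsetDl _ _)) hZc) => // eZ.
  by have := subsetP hZC s0; rewrite eZ (subsetP HC) // in_setD hs0 => /(_ isT).
have uP := inP u (set21 u v); have vP := inP v (set22 u v).
have PC' : P \subset C' by apply: subsetUr.
have hmc : minimal_cycle d C'.
  split=> //; first by apply/set0Pn; exists (u |: N); apply: (subsetP PC').
  move=> Z hZ hZc; have [uZ|uZ] := boolP (u |: N \in Z); last by left; apply: Zempty.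
  (* The complement of Z in C' is again a cycle, and it omits [u |: N]. *)
  right; have := Zempty (C' :\: Z) (subsetDl _ _) (is_cycleD hZ C'cyc hZc).
  rewrite in_setD uZ => /(_ isT)/eqP; rewrite setD_eq0 => h.
  by apply/eqP; rewrite eqEsubset hZ.
have d0 : [disjoint (set0 : {set V}) & vert C'] by rewrite -setI_eq0 set0I.
have h0 : #|(set0 : {set V})| + d = d by rewrite cards0.
have hrig := fogelsanger phi_gen h3 h0 d0 hmc.
apply: (@redundant_closure (set0 :|: vert C')).
- by rewrite set0U; apply/vertP; exists (u |: N); rewrite ?setU11 ?(subsetP PC').
- by rewrite set0U; apply/vertP; exists (v |: N); rewrite ?setU11 ?(subsetP PC').
apply: (rigid_mono _ (subxx _) hrig); apply/subsetP => q /join_graphP [cq [s hs]];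
  rewrite set0U => hqs.
(* Here d >= 4 gives |N| >= 3, so an edge q of a new simplex misses some x in N and already lies in
   the facet of H omitting x. *)
have card2 : 2 < #|N| by rewrite -ltnS cN.
have [x /setDP [xN xq]] : exists x, x \in N :\: q.
  apply/set0Pn; rewrite setD_eq0; apply: contraL card2 => h.
  by rewrite -leqNgt -cq subset_leq_card.
have eN w : w \in e -> q \subset w |: N -> q \in G :\ e.
  move=> we hq; rewrite in_setD1 /graph_edges inE cq eqxx andbT (subH x) //; last first.
    by rewrite subsetD1 xq andbT (subset_trans hq) // setSU // sub1set.
  rewrite andbT; apply: contraTneq hq => ->;
    rewrite subUset !sub1set !in_setU1 (negPf uN) (negPf vN) !orbF.
  by move: we; rewrite in_set2 => /orP [] /eqP ->; rewrite eqxx /= ?andbT // eq_sym.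
move: hs; rewrite in_setU => /orP [/setDP [sC sH]|/PP [es|es]].
- rewrite in_setD1 /graph_edges inE cq eqxx andbT (Dsub (facet_in sC) hqs) andbT.
  by apply: contraNneq sH => eq; rewrite inH sC -eq.
- by apply: (eN u); rewrite ?set21 // -es.
- by apply: (eN v); rewrite ?set22 // -es.
Qed.

End Final.

Lemma rigid_rank (R : realFieldType) (V : finType) (d : nat) (phi : V -> 'rV[R]_d)
    (E : {set {set V}}) :
  generic_embedding phi -> d <= #|V| -> is_graph E -> rigid phi E [set: V] ->
  ((\rank (rig_mx E phi))%:Z = (d * #|V|)%:Z - ('C(d.+1, 2))%:Z)%R.
Proof.
move=> hphi dV gE hE.
have hr := rank_pairs hphi (U := [set: V]); rewrite cardsT in hr.
have aP := @bars_antisym R V d phi.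
have -> : \rank (rig_mx E phi) = \rank (bar_mx (pairs [set: V]) (bars phi)).
  rewrite rig_mxE; apply/eqP; rewrite eqn_leq; apply/andP; split; apply: mxrankS.
    apply/(bar_mx_subP (@pairs_is_graph V _) gE aP aP) => mu hmu a b hab _; apply: hmu => //.
    by rewrite in_pairs // !inE.
  by apply/(bar_mx_subP gE (@pairs_is_graph V _) aP aP)/rigidP.
by rewrite -(hr dV) PoszD addrK.
Qed.

Theorem theorem3p4 (F : fieldType) (V : finType) (D : {set {set V}}) (d : nat) :
  (4 <= d)%N ->
  is_complex D ->
  homology_sphere F D d ->
  prime_cx D d ->
  (0 < g2 D d)%R ->
  forall e : {set V}, e \in graph_edges D ->
    generically_rigid (graph_edges D :\ e) d.
Proof.
move=> hd Dc Ds Dp Dg2 e0 he0 R phi hphi.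
have /setIdP [he /cards2P [u [v [huv ee]]]] := he0; rewrite {}ee in he *.
apply: rigid_rank => //.
- have [s hs _] := facet_ex Ds he.
  by rewrite -(facet_card hs) max_card.
- by move=> q; rewrite in_setD1 => /andP [_ /setIdP [_ /eqP]].
pose missing (S : {set V}) := (S \notin D) && [forall s : {set V}, (s \proper S) ==> (s \in D)].
have [/existsP [S /and3P [/andP [nS /forallP pS] eS cS]]|hno] :=
    boolP [exists S : {set V}, [&& missing S, [set u; v] \subset S & 2 < #|S|]].
  by apply: (redundant_missing hd Dc Ds Dp Dg2 hphi huv he nS _ eS cS) => s; apply/implyP.
(* A minimal non-face inside u, v and t contains both u and v, and has a third vertex because uv is
   a face; it would be a missing face excluded by [hno]. *)
have link t : u |: t \in D -> v |: t \in D -> u |: (v |: t) \in D.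
  move=> hu hv; apply/negPn/negP => hn.
  have [S /minsetP [nS hmin] hS] := @minset_exists _ (fun A => A \notin D) _ hn.
  have sub := proj1 Dc.
  have uS : u \in S.
    apply: contraR nS => uS; apply: (sub _ _ hv); apply/subsetP => x xS.
    have := subsetP hS x xS; rewrite in_setU1 => /orP [/eqP ex|//].
    by rewrite -ex xS in uS.
  have vS : v \in S.
    apply: contraR nS => vS; apply: (sub _ _ hu); apply/subsetP => x xS.
    have := subsetP hS x xS; rewrite !in_setU1 => /or3P [->//|/eqP ex|->]; last by rewrite orbT.
    by rewrite -ex xS in vS.
  have eS : [set u; v] \subset S by rewrite subUset !sub1set uS.
  case/negP: hno; apply/existsP; exists S; rewrite eS /missing nS /=; apply/andP; split.
    apply/forallP => s; apply/implyP => /properP [hs [x xS xs]].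
    by apply/negPn/negP => ns; case/negP: xs; rewrite (hmin s ns hs).
  rewrite ltnNge; apply: contra nS => cS.
  by have /eqP <- : [set u; v] == S by rewrite eqEcard eS cards2 huv.
have [hN|hN] := leqP d #|vert (hinge d u v (off_edge u v (faces D d))) :\: [set u; v]|.
- exact: (redundant_contract hd Dc Ds Dg2 hphi huv he link hN).
- exact: (redundant_flip hd Dc Ds Dp Dg2 hphi huv he hN).
Qed.
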